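(* Let $n\ge1$ and $u\in\mathbb C$ with $u\neq0$, and let $\ddot{\mathfrak H}^{\mathfrak c}$ and $\ddot{\mathfrak H}^-$ be the rational double affine Hecke-Clifford algebra and the rational spin double affine Hecke algebra with the same parameter $u$. There exists a superalgebra isomorphism $$\Phi:\ \ddot{\mathfrak H}^{\mathfrak c}\xrightarrow{\ \cong\ }\mathcal C_n\otimes\ddot{\mathfrak H}^-,\qquad y_i\mapsto y_i,\quad c_i\mapsto c_i,\quad x_i\mapsto\sqrt{-2}\,c_i\xi_i,\quad s_i\mapsto\frac1{\sqrt{-2}}(c_i-c_{i+1})t_i,$$ and its inverse $\Psi$ is given by $$y_i\mapsto y_i,\quad c_i\mapsto c_i,\quad \xi_i\mapsto\frac1{\sqrt{-2}}c_ix_i,\quad t_i\mapsto\frac1{\sqrt{-2}}(c_{i+1}-c_i)s_i.$$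
   Context: $\sqrt{-2}$ is a fixed square root of $-2$ in $\mathbb C$. $S_n$ is the symmetric group, $s_{ij}$ the transposition of $i$ and $j$, $s_i=s_{i,i+1}$. $\mathcal C_n$ is the Clifford algebra over $\mathbb C$ generated by odd elements $c_1,\dots,c_n$ with $c_i^2=1$, $c_ic_j=-c_jc_i$ ($i\ne j$). The rational double affine Hecke-Clifford algebra $\ddot{\mathfrak H}^{\mathfrak c}$ with parameter $u\in\mathbb C$ is the associative unital $\mathbb C$-algebra generated by $x_i,y_i,c_i$ ($1\le i\le n$) and $S_n$ (with the relations of the group $S_n$), subject to: $x_ix_j=x_jx_i$, $y_iy_j=y_jy_i$ for all $i,j$; $\sigma x_i=x_{\sigma(i)}\sigma$, $\sigma y_i=y_{\sigma(i)}\sigma$, $\sigma c_i=c_{\sigma(i)}\sigma$ for $\sigma\in S_n$; $c_ix_i=-x_ic_i$, $c_iy_i=y_ic_i$; $c_jx_i=x_ic_j$, $c_jy_i=y_ic_j$ for $i\neq j$; $c_i^2=1$, $c_ic_j=-c_jc_i$ for $i\neq j$; $[y_j,x_i]=u(1+c_jc_i)s_{ij}$ for $i\ne j$; $[y_i,x_i]=-u\sum_{k\neq i}(1+c_kc_i)s_{ki}$. It is a superalgebra with $c_i$ odd and $x_i,y_i,s_{ij}$ even. The rational spin double affine Hecke algebra $\ddot{\mathfrak H}^-$ with parameter $u\in\mathbb C$ is the $\mathbb C$-algebra generated by $\xi_i,y_i$ ($1\le i\le n$) and $t_i$ ($1\le i\le n-1$), subject to: $t_i^2=1$, $t_it_{i+1}t_i=t_{i+1}t_it_{i+1}$,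 $t_it_j=-t_jt_i$ for $|i-j|>1$; $\xi_i\xi_j=-\xi_j\xi_i$, $y_iy_j=y_jy_i$ for $i\neq j$; $t_i\xi_i=-\xi_{i+1}t_i$, $t_iy_i=y_{i+1}t_i$; $t_j\xi_i=-\xi_it_j$, $t_jy_i=y_it_j$ for $i\neq j,j+1$; the commutator relations $y_i\xi_j-\xi_jy_i=u[i,j]$ for $i\ne j$, and $y_i\xi_i-\xi_iy_i=u\sum_{k\neq i}[i,k]$, where for $1\le i<j\le n$, $[i,j]=-[j,i]=(-1)^{j-i-1}t_{j-1}\cdots t_{i+1}t_it_{i+1}\cdots t_{j-1}$. It is a superalgebra with $y_i$ even and $\xi_i,t_i$ odd. The tensor product of superalgebras has multiplication $(c'\otimes b')(c\otimes b)=(-1)^{|b'||c|}(c'c\otimes b'b)$ for homogeneous $b',c$; one writes $cb$ for $c\otimes b$, $c=c\otimes1$, $b=1\otimes b$. *)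

(* Defs.v *)
From HB Require Import structures.
From mathcomp Require Import all_boot all_algebra all_fingroup.
From mathcomp Require Import boolp.
From mathcomp Require Import finmap.
From mathcomp.multinomials Require Import monalg.

Set Implicit Arguments.
Unset Strict Implicit.
Unset Printing Implicit Defensive.

Import GRing.Theory.
Local Open Scope ring_scope.
Local Open Scope quotient_scope.

(* An associative unital superalgebra A = A_0 (+) A_1 over K.  The grading is
   recorded by the projections [hcomp b : A -> A_b], with b = true for odd.
   The rings below are [pzRingType]s because algebras given by generators and
   relations are not known a priori to be nonzero; this excludes the library's
   [algType], whose rings satisfy 1 != 0. *)
Record superAlgebra (K : comNzRingType) := SuperAlgebra {
  sa_ring : pzRingType;
  sa_scale : K -> sa_ring -> sa_ring;
  sa_scaleA : forall a b x, sa_scale a (sa_scale b x) = sa_scale (a * b) x;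
  sa_scale1 : left_id 1 sa_scale;
  sa_scaleDr : right_distributive sa_scale +%R;
  sa_scaleDl : forall x, {morph sa_scale^~ x : a b / a + b};
  sa_scaleAl : forall k x y, sa_scale k (x * y) = sa_scale k x * y;
  sa_scaleAr : forall k x y, sa_scale k (x * y) = x * sa_scale k y;
  sa_comp : bool -> sa_ring -> sa_ring;
  sa_comp_linear : forall b k x y,
    sa_comp b (sa_scale k x + y) = sa_scale k (sa_comp b x) + sa_comp b y;
  sa_comp_sum : forall x, sa_comp false x + sa_comp true x = x;
  sa_comp_comp : forall b b' x,
    sa_comp b (sa_comp b' x) = if b == b' then sa_comp b x else 0;
  sa_comp1 : sa_comp false 1 = 1;
  sa_compM : forall b b' x y, sa_comp (b (+) b') (sa_comp b x * sa_comp b' y)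
                              = sa_comp b x * sa_comp b' y
}.

Definition sa_sort (K : comNzRingType) (A : superAlgebra K) : Type := sa_ring A.
Coercion sa_sort : superAlgebra >-> Sortclass.

HB.instance Definition _ (K : comNzRingType) (A : superAlgebra K) :=
  GRing.PzRing.copy (sa_sort A) (sa_ring A).
HB.instance Definition _ (K : comNzRingType) (A : superAlgebra K) :=
  GRing.Zmodule_isLmodule.Build K (sa_sort A)
    (@sa_scaleA K A) (@sa_scale1 K A) (@sa_scaleDr K A) (@sa_scaleDl K A).

Section SuperAlgebraTheory.
Variables (K : comNzRingType) (A : superAlgebra K).

Definition hcomp (b : bool) (x : A) : A := sa_comp b x.

Definition homog (b : bool) (x : A) : Prop := hcomp b x = x.

Lemma hcomp_linear b k (x y : A) :
  hcomp b (k *: x + y) = k *: hcomp b x + hcomp b y.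
Proof. exact: sa_comp_linear. Qed.

Lemma hcompD b (x y : A) : hcomp b (x + y) = hcomp b x + hcomp b y.
Proof. by have := hcomp_linear b 1 x y; rewrite !scale1r. Qed.

Lemma hcomp0 b : hcomp b 0 = 0 :> A.
Proof. by apply: (addIr (hcomp b 0)); rewrite -hcompD !add0r. Qed.

Lemma hcompZ b k (x : A) : hcomp b (k *: x) = k *: hcomp b x.
Proof. by have := hcomp_linear b k x 0; rewrite hcomp0 !addr0. Qed.

Lemma hcomp_sum (x : A) : hcomp false x + hcomp true x = x.
Proof. exact: sa_comp_sum. Qed.

Lemma hcomp_comp b b' (x : A) :
  hcomp b (hcomp b' x) = if b == b' then hcomp b x else 0.
Proof. exact: sa_comp_comp. Qed.

Lemma hcomp_hom b b' (x : A) :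
  homog b x -> hcomp b' x = if b' == b then x else 0.
Proof. by rewrite /homog => hx; rewrite -hx hcomp_comp; case: eqP => // ->. Qed.

Lemma homog_comp b (x : A) : homog b (hcomp b x).
Proof. by rewrite /homog hcomp_comp eqxx. Qed.

Lemma homog1 : homog false (1 : A).
Proof. exact: sa_comp1. Qed.

Lemma homogM b b' (x y : A) : homog b x -> homog b' y -> homog (b (+) b') (x * y).
Proof. by rewrite /homog => <- <-; exact: sa_compM. Qed.

Lemma homog0 b : homog b (0 : A). Proof. exact: hcomp0. Qed.

Lemma homogD b (x y : A) : homog b x -> homog b y -> homog b (x + y).
Proof. by rewrite /homog hcompD => -> ->. Qed.

Lemma homogZ b k (x : A) : homog b x -> homog b (k *: x).
Proof. by rewrite /homog hcompZ => ->. Qed.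

Lemma homogN b (x : A) : homog b x -> homog b (- x).
Proof. by rewrite -scaleN1r; exact: homogZ. Qed.

Lemma homogB b (x y : A) : homog b x -> homog b y -> homog b (x - y).
Proof. by move=> hx /homogN; exact: homogD. Qed.

Lemma homog_sum (I : Type) (r : seq I) (Q : pred I) b (F : I -> A) :
  (forall i, Q i -> homog b (F i)) -> homog b (\sum_(i <- r | Q i) F i).
Proof.
move=> h; elim/big_rec: _ => [|i x Qi hx]; first exact: homog0.
by apply: homogD => //; exact: h.
Qed.

Lemma hcompM b (x y : A) :
  hcomp b (x * y) = \sum_(i : bool) hcomp i x * hcomp (b (+) i) y.
Proof.
rewrite big_bool /= -[in LHS](hcomp_sum x) -[in LHS](hcomp_sum y).
rewrite mulrDl !mulrDr !hcompD.
have h i j : hcomp b (hcomp i x * hcomp j y)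
    = if b == i (+) j then hcomp i x * hcomp j y else 0.
  exact: (hcomp_hom b (homogM (homog_comp i x) (homog_comp j y))).
by rewrite !h; case: b {h} => /=; rewrite ?addr0 ?add0r // addrC.
Qed.

Lemma superAl k (x y : A) : k *: (x * y) = (k *: x) * y.
Proof. exact: sa_scaleAl. Qed.

Lemma superAr k (x y : A) : k *: (x * y) = x * (k *: y).
Proof. exact: sa_scaleAr. Qed.

End SuperAlgebraTheory.

Definition superalg_morph (K : comNzRingType) (A B : superAlgebra K)
    (f : A -> B) : Prop :=
  [/\ linear f, monoid_morphism f & forall b x, homog b x -> homog b (f x)].

Section QuotientModule.
Variables (K : comNzRingType) (V : lmodType K).

Inductive span (S : V -> Prop) : V -> Prop :=
| span_gen v of S v : span S v
| span_0 : span S 0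
| span_lin k u v of span S u & span S v : span S (k *: u + v).

Definition span_pred S : {pred V} := fun v => `[< span S v >].

Variable S : V -> Prop.

Lemma span_pred_closed : subsemimod_closed (span_pred S).
Proof.
split; first split.
- by apply/asboolP; exact: span_0.
- move=> u v /asboolP hu /asboolP hv; apply/asboolP.
  by rewrite -[u]scale1r; exact: span_lin.
- move=> k v /asboolP hv; apply/asboolP; rewrite -[_ *: _]addr0.
  by apply: span_lin => //; exact: span_0.
Qed.
HB.instance Definition _ :=
  GRing.isSubmodClosed.Build K V (span_pred S) span_pred_closed.

Definition quotmod : Type := Quotient.quot (span_pred S).
HB.instance Definition _ := 
  GRing.Zmodule.copy quotmod (Quotient.quot (span_pred S)).

End QuotientModule.

HB.lock Definition qpi (K : comNzRingType) (V : lmodType K) (S : V -> Prop)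
    (v : V) : quotmod S := \pi_(Quotient.quot (span_pred S)) v.
HB.lock Definition qrepr (K : comNzRingType) (V : lmodType K) (S : V -> Prop)
    (x : quotmod S) : V :=
  generic_quotient.repr (x : Quotient.quot (span_pred S)).

Section QuotientModuleTheory.
Variables (K : comNzRingType) (V : lmodType K) (S : V -> Prop).

Local Notation quotmod := (quotmod S).
Local Notation qpi := (@qpi K V S).
Local Notation qrepr := (@qrepr K V S).

Lemma qreprK : cancel qrepr qpi.
Proof. by move=> x; rewrite qpi.unlock qrepr.unlock; exact: reprK. Qed.

Lemma qsurj x : exists v, x = qpi v.
Proof. by exists (qrepr x); rewrite qreprK. Qed.

Lemma qpi_eq u v : qpi u = qpi v <-> span S (u - v).
Proof.
rewrite qpi.unlock; split=> [/eqP|h]; first by rewrite -Quotient.idealrBE => /asboolP.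
by apply/eqP; rewrite -Quotient.idealrBE; apply/asboolP.
Qed.

Lemma qpiD u v : qpi (u + v) = qpi u + qpi v.
Proof. by rewrite qpi.unlock; exact: Quotient.pi_add. Qed.

Lemma qpi_qrepr v : span S (qrepr (qpi v) - v).
Proof. by apply/qpi_eq; rewrite qreprK. Qed.

Lemma spanZ k v : span S v -> span S (k *: v).
Proof.
by move=> h; rewrite -[_ *: _]addr0; apply: span_lin => //; exact: span_0.
Qed.

Lemma spanD u v : span S u -> span S v -> span S (u + v).
Proof. by move=> hu hv; rewrite -[u]scale1r; exact: span_lin. Qed.

Definition qscale (k : K) (x : quotmod) : quotmod := qpi (k *: qrepr x).

Lemma qpiZ_subproof k v : qscale k (qpi v) = qpi (k *: v).
Proof. by apply/qpi_eq; rewrite -scalerBr; apply: spanZ; exact: qpi_qrepr. Qed.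

Fact qscaleA a b x : qscale a (qscale b x) = qscale (a * b) x.
Proof. by rewrite -[x]qreprK !qpiZ_subproof scalerA. Qed.
Fact qscale1 : left_id 1 qscale.
Proof. by move=> x; rewrite -[x]qreprK !qpiZ_subproof scale1r. Qed.
Fact qscaleDr : right_distributive qscale +%R.
Proof.
move=> k x y; rewrite -[x]qreprK -[y]qreprK -qpiD !qpiZ_subproof.
by rewrite scalerDr qpiD.
Qed.
Fact qscaleDl x : {morph qscale^~ x : a b / a + b}.
Proof. by move=> a b; rewrite -[x]qreprK /= !qpiZ_subproof scalerDl qpiD. Qed.

HB.instance Definition _ :=
  GRing.Zmodule_isLmodule.Build K quotmod qscaleA qscale1 qscaleDr qscaleDl.

Lemma qpi_linear : linear qpi.
Proof. by move=> k u v; rewrite qpiD -qpiZ_subproof. Qed.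
HB.instance Definition _ := GRing.isLinear.Build K V quotmod _ qpi qpi_linear.

End QuotientModuleTheory.

Definition mpar (G : choiceType) (p : G -> bool) (m : {fmonom G}) : bool :=
  odd (count p m).

HB.lock Definition fcomp (K : comNzRingType) (G : choiceType) (p : G -> bool)
    (b : bool) (f : {malg K[{fmonom G}]}) : {malg K[{fmonom G}]} :=
  \sum_(m <- msupp f | mpar p m == b) << f@_m *g m >>.

Section FreeSuperAlgebra.
Variables (K : comNzRingType) (G : choiceType) (p : G -> bool).

Local Notation F := {malg K[{fmonom G}]}.
Local Notation mpar := (mpar p).
Local Notation fcomp := (@fcomp K G p).

Definition fgen (g : G) : F := << fmu g >>.

Definition fhomog (b : bool) (f : F) : Prop := fcomp b f = f.

Lemma mparM m1 m2 : mpar (mmul m1 m2) = mpar m1 (+) mpar m2.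
Proof. by rewrite /Pilot.Defs.mpar fmM count_cat oddD. Qed.

Lemma mpar1 : mpar mone = false.
Proof. by rewrite /Pilot.Defs.mpar fm1. Qed.

Lemma fcompE b f m : (fcomp b f)@_m = if mpar m == b then f@_m else 0.
Proof.
rewrite fcomp.unlock raddf_sum /=.
have [mf|mf] := boolP (m \in msupp f); last first.
  rewrite (mcoeff_outdom mf) if_same big_seq_cond big1 // => m' /andP[m'f _].
  by rewrite mcoeffU; case: eqP m'f => [->|]; rewrite ?(negPf mf).
rewrite -big_filter; case: ifP => hm.
  rewrite (bigD1_seq m) /= ?mem_filter ?hm ?filter_uniq //.
  by rewrite mcoeffUU big1 ?addr0 // => m' /negPf; rewrite mcoeffU => ->.
rewrite big_filter big1 // => m' hm'; rewrite mcoeffU.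
by have [e|//] := eqVneq m' m; rewrite e hm in hm'.
Qed.

Lemma fcomp_linear b k f g : fcomp b (k *: f + g) = k *: fcomp b f + fcomp b g.
Proof.
apply/malgP => m; rewrite mcoeffD mcoeffZ !fcompE mcoeffD mcoeffZ.
by case: (mpar m == b); rewrite ?mulr0 ?addr0.
Qed.

Lemma fcompD b f g : fcomp b (f + g) = fcomp b f + fcomp b g.
Proof. by have := fcomp_linear b 1 f g; rewrite !scale1r. Qed.

Lemma fcomp0 b : fcomp b 0 = 0.
Proof. by apply/malgP => m; rewrite fcompE mcoeff0 if_same. Qed.

Lemma fcomp_sum f : fcomp false f + fcomp true f = f.
Proof.
apply/malgP => m; rewrite mcoeffD !fcompE.
by case: (mpar m); rewrite ?add0r ?addr0.
Qed.

Lemma fcomp_comp b b' f :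
  fcomp b (fcomp b' f) = if b == b' then fcomp b f else 0.
Proof.
apply/malgP => m; rewrite !fcompE.
have [<-|ne] := eqVneq b b'; first by rewrite fcompE; case: (mpar m == b).
by rewrite mcoeff0; case: (mpar m =P b) => // ->; rewrite (negPf ne).
Qed.

Lemma fhomogP b f : fhomog b f <-> forall m, m \in msupp f -> mpar m = b.
Proof.
split=> [hf m|h]; last first.
  apply/malgP => m; rewrite fcompE; case: (msuppP f m) => [/h->|]; first by rewrite eqxx.
  by rewrite if_same.
by rewrite -mcoeff_neq0 -hf fcompE; case: (mpar m =P b) => // _; rewrite eqxx.
Qed.

Lemma fhomog_comp b f : fhomog b (fcomp b f).
Proof. by rewrite /fhomog fcomp_comp eqxx. Qed.

Lemma fhomogM b b' f g : fhomog b f -> fhomog b' g -> fhomog (b (+) b') (f * g).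
Proof.
move=> /fhomogP hf /fhomogP hg; apply/fhomogP => m.
by move=> /msuppM_le[m1 [m2 [/hf<- /hg<- ->]]]; exact: mparM.
Qed.

Lemma fhomog1 : fhomog false 1.
Proof.
by apply/fhomogP => m; rewrite msuppU1 inE => /eqP->; exact: mpar1.
Qed.

Lemma fhomog_gen g : fhomog (p g) (fgen g).
Proof.
apply/fhomogP => m; rewrite msuppU1 inE => /eqP->.
by rewrite /Pilot.Defs.mpar fmuE /= addn0 oddb.
Qed.

Lemma fcomp1 : fcomp false 1 = 1. Proof. exact: fhomog1. Qed.

Lemma fcompMM b b' f g :
  fcomp (b (+) b') (fcomp b f * fcomp b' g) = fcomp b f * fcomp b' g.
Proof. exact: fhomogM (fhomog_comp b f) (fhomog_comp b' g). Qed.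

Lemma fscaleAr k (f g : F) : k *: (f * g) = f * (k *: g).
Proof.
have h (x : F) : k%:MP * x = x * k%:MP.
  rewrite (monalgE x) mulr_sumr mulr_suml; apply: eq_bigr => m _.
  by rewrite !malgM_def /malgC !fgmulUU mul1m mulm1 mulrC.
by rewrite -!mul_malgC !mulrA h.
Qed.

(* The free associative algebra on G, graded by declaring g odd iff [p g]. *)
Definition free_superalg : superAlgebra K :=
  @SuperAlgebra K F *:%R (@scalerA K F) (@scale1r K F)
    (@scalerDr K F) (@scalerDl K F) (@scalerAl K F) fscaleAr
    fcomp fcomp_linear fcomp_sum fcomp_comp fcomp1 fcompMM.

Definition fvar (g : G) : free_superalg := fgen g.

Lemma homog_fvar g : homog (p g) (fvar g).
Proof. exact: fhomog_gen. Qed.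

End FreeSuperAlgebra.

Section QuotientSuperAlgebra.
Variables (K : comNzRingType) (A : superAlgebra K) (rel : A -> A -> Prop).

(* Generators, as a K-module, of the two-sided ideal of the relators. *)
Inductive ideal_gen : A -> Prop :=
| IdealGen (a c l r : A) of rel l r : ideal_gen (a * (l - r) * c).

Definition aquot : Type := quotmod ideal_gen.
HB.instance Definition _ := GRing.Lmodule.copy aquot (quotmod ideal_gen).

End QuotientSuperAlgebra.

HB.lock Definition aquot_mul (K : comNzRingType) (A : superAlgebra K)
    (rel : A -> A -> Prop) (x y : aquot rel) : aquot rel :=
  @qpi K A (ideal_gen rel) (@qrepr K A (ideal_gen rel) x * @qrepr K A (ideal_gen rel) y).
HB.lock Definition aquot_comp (K : comNzRingType) (A : superAlgebra K)
    (rel : A -> A -> Prop) (b : bool) (x : aquot rel) : aquot rel :=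
  @qpi K A (ideal_gen rel) (hcomp b (@qrepr K A (ideal_gen rel) x)).

Section QuotientSuperAlgebraTheory.
Variables (K : comNzRingType) (A : superAlgebra K) (rel : A -> A -> Prop).
Hypothesis rel_homog : forall l r, rel l r -> exists b, homog b (l - r).

Local Notation ideal_gen := (@ideal_gen K A rel).
Local Notation aquot := (@aquot K A rel).
Local Notation aquot_mul := (@aquot_mul K A rel).
Local Notation aquot_comp := (@aquot_comp K A rel).
Local Notation pi := (@qpi K A ideal_gen : A -> aquot).
Local Notation rep := (@qrepr K A ideal_gen : aquot -> A).

Definition aquot_one : aquot := pi 1.

Lemma ideal_mull a x : span ideal_gen x -> span ideal_gen (a * x).
Proof.
elim=> {x} [_ [a' c l r h]||k u v _ hu _ hv].
- by rewrite !mulrA -[a * a' * _]mulrA mulrA; apply: span_gen; exact: IdealGen.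
- by rewrite mulr0; exact: span_0.
- by rewrite mulrDr -superAr; exact: span_lin.
Qed.

Lemma ideal_mulr a x : span ideal_gen x -> span ideal_gen (x * a).
Proof.
elim=> {x} [_ [a' c l r h]||k u v _ hu _ hv].
- by rewrite -!mulrA [a' * _]mulrA; apply: span_gen; exact: IdealGen.
- by rewrite mul0r; exact: span_0.
- by rewrite mulrDl -superAl; exact: span_lin.
Qed.

Lemma ideal_rel l r : rel l r -> span ideal_gen (l - r).
Proof.
move=> h; rewrite -[l - r]mul1r -[1 * _]mulr1.
by apply: span_gen; exact: IdealGen.
Qed.

Lemma ideal_comp b x : span ideal_gen x -> span ideal_gen (hcomp b x).
Proof.
elim=> {x} [_ [a c l r h]||k u v _ hu _ hv]; last first.
- by rewrite hcomp_linear; exact: span_lin.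
- by rewrite hcomp0; exact: span_0.
have [d hd] := rel_homog h.
have hr e : span ideal_gen (hcomp e (l - r)).
  rewrite (hcomp_hom e hd); case: eqP => _; last exact: span_0.
  exact: ideal_rel.
have ha e : span ideal_gen (hcomp e (a * (l - r))).
  by rewrite hcompM big_bool; apply: spanD; apply: ideal_mull; exact: hr.
by rewrite hcompM big_bool; apply: spanD; apply: ideal_mulr; exact: ha.
Qed.

Lemma pi_mulE f g : aquot_mul (pi f) (pi g) = pi (f * g).
Proof.
rewrite Pilot.Defs.aquot_mul.unlock; apply/qpi_eq; set f' := qrepr _; set g' := qrepr _.
have -> : f' * g' - f * g = (f' - f) * g' + f * (g' - g).
  by rewrite mulrBl mulrBr addrA subrK.
by apply: spanD; [apply: ideal_mulr|apply: ideal_mull]; exact: qpi_qrepr.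
Qed.

Lemma pi_compE b f : aquot_comp b (pi f) = pi (hcomp b f).
Proof.
rewrite Pilot.Defs.aquot_comp.unlock.
apply/qpi_eq; rewrite -scaleN1r addrC -hcomp_linear scaleN1r addrC.
by apply: ideal_comp; exact: qpi_qrepr.
Qed.

Fact aquot_mulA : associative aquot_mul.
Proof.
move=> x y z; have [[f ->] [g ->] [h ->]] := And3 (qsurj x) (qsurj y) (qsurj z).
by rewrite (pi_mulE g h) (pi_mulE f g) (pi_mulE _ h) (pi_mulE f) mulrA.
Qed.
Fact aquot_mul1 : left_id aquot_one aquot_mul.
Proof. by move=> x; rewrite -[x]qreprK pi_mulE mul1r. Qed.
Fact aquot_mulr1 : right_id aquot_one aquot_mul.
Proof. by move=> x; rewrite -[x]qreprK pi_mulE mulr1. Qed.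
Fact aquot_mulDl : left_distributive aquot_mul +%R.
Proof.
move=> x y z; rewrite -[x]qreprK -[y]qreprK -[z]qreprK.
by rewrite -(qpiD _ (rep x)) !pi_mulE mulrDl qpiD.
Qed.
Fact aquot_mulDr : right_distributive aquot_mul +%R.
Proof.
move=> x y z; rewrite -[x]qreprK -[y]qreprK -[z]qreprK.
by rewrite -(qpiD _ (rep y)) !pi_mulE mulrDr qpiD.
Qed.

HB.instance Definition _ := GRing.Zmodule_isPzRing.Build aquot
  aquot_mulA aquot_mul1 aquot_mulr1 aquot_mulDl aquot_mulDr.

Fact aquot_scaleAl k (x y : aquot) : k *: (x * y) = (k *: x) * y.
Proof.
rewrite -[x]qreprK -[y]qreprK [pi _ * _]pi_mulE.
rewrite -[LHS]linearZ -[k *: pi _]linearZ /=.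
by rewrite [RHS]pi_mulE -superAl.
Qed.
Fact aquot_scaleAr k (x y : aquot) : k *: (x * y) = x * (k *: y).
Proof.
rewrite -[x]qreprK -[y]qreprK [pi _ * _]pi_mulE.
rewrite -[LHS]linearZ -[k *: pi _]linearZ /=.
by rewrite [RHS]pi_mulE -superAr.
Qed.
Fact aquot_comp_linear b k (x y : aquot) :
  aquot_comp b (k *: x + y) = k *: aquot_comp b x + aquot_comp b y.
Proof.
rewrite -[x]qreprK -[y]qreprK -[k *: _ + _]linearP !pi_compE hcomp_linear.
exact: linearP.
Qed.
Fact aquot_comp_sum (x : aquot) : aquot_comp false x + aquot_comp true x = x.
Proof. by rewrite -[x]qreprK !pi_compE -[LHS]qpiD hcomp_sum. Qed.
Fact aquot_comp_comp b b' (x : aquot) :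
  aquot_comp b (aquot_comp b' x) = if b == b' then aquot_comp b x else 0.
Proof.
have [v ->] := qsurj x; rewrite (pi_compE b' v) (pi_compE b) hcomp_comp.
case: ifP => _; first by rewrite pi_compE.
exact: (linear0 (@qpi K A ideal_gen)).
Qed.
Fact aquot_comp1 : aquot_comp false (1 : aquot) = 1.
Proof. by rewrite [LHS]pi_compE homog1. Qed.
Fact aquot_compM b b' (x y : aquot) :
  aquot_comp (b (+) b') (aquot_comp b x * aquot_comp b' y)
  = aquot_comp b x * aquot_comp b' y.
Proof.
have [[f ->] [g ->]] := conj (qsurj x) (qsurj y).
have e u v : pi u * pi v = pi (u * v) := pi_mulE u v.
rewrite (pi_compE b f) (pi_compE b' g) e (pi_compE _ (_ * _)).
by rewrite (homogM (homog_comp b _) (homog_comp b' _)).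
Qed.

(* A modulo the relations l = r, for l and r such that [rel l r]. *)
Definition quot_superalg : superAlgebra K :=
  @SuperAlgebra K aquot *:%R (@scalerA K aquot) (@scale1r K aquot)
    (@scalerDr K aquot) (@scalerDl K aquot) aquot_scaleAl aquot_scaleAr
    aquot_comp aquot_comp_linear aquot_comp_sum aquot_comp_comp
    aquot_comp1 aquot_compM.

Definition quot_pi (f : A) : quot_superalg := pi f.

Lemma quot_pi_morph : superalg_morph quot_pi.
Proof.
split; first exact: (@qpi_linear K A ideal_gen).
  by split=> // f g; apply/esym; exact: pi_mulE.
by move=> b x hx; rewrite /homog [LHS]pi_compE hx.
Qed.

Lemma quot_pi_rel l r : rel l r -> quot_pi l = quot_pi r.
Proof. by move=> h; apply/qpi_eq; exact: ideal_rel. Qed.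

Lemma quot_pi_surj (x : quot_superalg) : exists f, x = quot_pi f.
Proof. by exists (rep x); rewrite /quot_pi qreprK. Qed.

End QuotientSuperAlgebraTheory.

Section Tensor.
Variables (K : comNzRingType) (A B : superAlgebra K).

Local Notation F := {malg K[(A * B)%type]}.

(* A (x) B is the free K-module on A * B modulo bilinearity. *)
Inductive bilin_rel : F -> Prop :=
| BilinL k a a' b :
    bilin_rel (<< (k *: a + a', b) >> - (k *: << (a, b) >> + << (a', b) >>))
| BilinR k a b b' :
    bilin_rel (<< (a, k *: b + b') >> - (k *: << (a, b) >> + << (a, b') >>)).

Definition tprod : Type := quotmod bilin_rel.
HB.instance Definition _ := GRing.Lmodule.copy tprod (quotmod bilin_rel).

Definition tpure (a : A) (b : B) : tprod := @qpi K F bilin_rel << (a, b) >>.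

Lemma tpureDl k a a' b : tpure (k *: a + a') b = k *: tpure a b + tpure a' b.
Proof.
rewrite -[RHS](linearP (@qpi K F bilin_rel)); apply/qpi_eq.
by apply: span_gen; exact: BilinL.
Qed.

Lemma tpureDr k a b b' : tpure a (k *: b + b') = k *: tpure a b + tpure a b'.
Proof.
rewrite -[RHS](linearP (@qpi K F bilin_rel)); apply/qpi_eq.
by apply: span_gen; exact: BilinR.
Qed.

Section Lift.
Variables (V : lmodType K).

Definition bilin (f : A -> B -> V) : Prop :=
  (forall k a a' b, f (k *: a + a') b = k *: f a b + f a' b) /\
  (forall k a b b', f a (k *: b + b') = k *: f a b + f a b').

Definition linext (f : A -> B -> V) (z : F) : V :=
  \sum_(q <- msupp z) z@_q *: f q.1 q.2.

(* The linear map A (x) B -> V induced by a bilinear f. *)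
Definition tlift (f : A -> B -> V) (x : tprod) : V := linext f (qrepr x).

Lemma linextEw f (d : {fset (A * B)%type}) (z : F) : (msupp z `<=` d)%fset ->
  linext f z = \sum_(q <- d) z@_q *: f q.1 q.2.
Proof.
move=> le; rewrite [LHS](big_fset_incl _ le) => //= q _ /mcoeff_outdom ->.
by rewrite scale0r.
Qed.

Lemma linext_linear f : linear (linext f).
Proof.
move=> k x y.
pose d := (msupp x `|` msupp y `|` msupp (k *: x + y))%fset.
rewrite !(@linextEw _ d) ?fsubsetUr //; last first.
- by rewrite /d -fsetUA fsubsetUl.
- by rewrite /d fsetUAC fsubsetUr.
rewrite scaler_sumr -big_split /=; apply: eq_bigr => q _.
by rewrite mcoeffD mcoeffZ scalerDl scalerA.
Qed.
HB.instance Definition _ f :=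
  GRing.isLinear.Build K F V _ (linext f) (linext_linear f).

Lemma linextU f a b : linext f << (a, b) >> = f a b.
Proof. by rewrite /linext msuppU oner_eq0 big_seq_fset1 mcoeffUU scale1r. Qed.

Lemma linext_span f z : bilin f -> span bilin_rel z -> linext f z = 0.
Proof.
move=> [hl hr]; elim=> {z} [_ [k a a' b|k a b b']||k u v _ hu _ hv].
- by rewrite linearB linearP /= !linextU hl subrr.
- by rewrite linearB linearP /= !linextU hr subrr.
- exact: linear0.
- by rewrite linearP /= hu hv scaler0 addr0.
Qed.

Lemma tlift_pi f (z : F) : bilin f -> tlift f (@qpi K F bilin_rel z) = linext f z.
Proof.
move=> hf; apply/eqP; rewrite -subr_eq0 -(linearB (linext f)); apply/eqP.
by apply: linext_span => //; exact: qpi_qrepr.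
Qed.

Lemma tliftE f a b : bilin f -> tlift f (tpure a b) = f a b.
Proof. by move=> hf; rewrite tlift_pi // linextU. Qed.

Lemma tlift_linear f : bilin f -> linear (tlift f).
Proof.
move=> hf k x y; have [[u ->] [v ->]] := conj (qsurj x) (qsurj y).
by rewrite -[k *: _ + _](linearP (@qpi K F bilin_rel)) !tlift_pi // linearP.
Qed.

End Lift.

Lemma tprod_ind (P : tprod -> Prop) :
  P 0 -> (forall k x y, P x -> P y -> P (k *: x + y)) ->
  (forall a b, P (tpure a b)) -> forall x, P x.
Proof.
move=> h0 hlin hp x; have [z ->] := qsurj x; rewrite (monalgE z) /=.
elim: (enum_fset (msupp z)) => [|[a b] r IH].
  by rewrite big_nil; have := h0; rewrite -(linear0 (@qpi K F bilin_rel)).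
rewrite big_cons.
have -> : << z@_(a, b) *g (a, b) >> = z@_(a, b) *: << (a, b) >> :> F.
  by apply/malgP => q; rewrite mcoeffZ !mcoeffU mulr_natr.
rewrite (linearP (@qpi K F bilin_rel)).
by apply: hlin; [exact: hp | exact: IH].
Qed.

Lemma tpure0l b : tpure 0 b = 0.
Proof.
have := tpureDl 1 0 0 b; rewrite !scale1r addr0 => /(congr1 (fun t => t - tpure 0 b)).
by rewrite subrr addrK.
Qed.
Lemma tpure0r a : tpure a 0 = 0.
Proof.
have := tpureDr 1 a 0 0; rewrite !scale1r addr0 => /(congr1 (fun t => t - tpure a 0)).
by rewrite subrr addrK.
Qed.
Lemma tpureDDl a a' b : tpure (a + a') b = tpure a b + tpure a' b.
Proof. by have := tpureDl 1 a a' b; rewrite !scale1r. Qed.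
Lemma tpureDDr a b b' : tpure a (b + b') = tpure a b + tpure a b'.
Proof. by have := tpureDr 1 a b b'; rewrite !scale1r. Qed.
Lemma tpureZl k a b : tpure (k *: a) b = k *: tpure a b.
Proof. by have := tpureDl k a 0 b; rewrite !addr0 tpure0l addr0. Qed.
Lemma tpureZr k a b : tpure a (k *: b) = k *: tpure a b.
Proof. by have := tpureDr k a b 0; rewrite !addr0 tpure0r addr0. Qed.

Definition tsign (i j : bool) : K := (-1) ^+ (i && j).

(* (c' (x) b')(c (x) b) = (-1)^(|b'||c|) c'c (x) b'b, extended to all b' and c
   by summing over their homogeneous components. *)
Definition tmul_pure (c' : A) (b' : B) (c : A) (b : B) : tprod :=
  \sum_(i : bool) \sum_(j : bool)
     tsign i j *: tpure (c' * hcomp j c) (hcomp i b' * b).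

End Tensor.

HB.lock Definition tmul (K : comNzRingType) (A B : superAlgebra K)
    (x y : tprod A B) : tprod A B :=
  tlift (fun c' b' => tlift (fun c b => tmul_pure c' b' c b) y) x.

HB.lock Definition tcomp (K : comNzRingType) (A B : superAlgebra K)
    (d : bool) (x : tprod A B) : tprod A B :=
  tlift (fun a b => \sum_(i : bool) tpure (hcomp i a) (hcomp (d (+) i) b)) x.

Section TensorTheory.
Variables (K : comNzRingType) (A B : superAlgebra K).

Local Notation tprod := (tprod A B).
Local Notation tmul := (@tmul K A B).
Local Notation tcomp := (@tcomp K A B).
Local Notation tpure := (@tpure K A B).
Local Notation tsign := (tsign K).

Definition tone : tprod := tpure 1 1.

Lemma tlift_lin (V : lmodType K) (f g h : A -> B -> V) k x :
  (forall a b, f a b = k *: g a b + h a b) ->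
  tlift f x = k *: tlift g x + tlift h x.
Proof.
move=> e; rewrite /tlift /linext scaler_sumr -big_split /=.
by apply: eq_bigr => q _; rewrite e scalerDr !scalerA mulrC.
Qed.

Lemma bilin_tmul_pure (c' : A) (b' : B) : bilin (tmul_pure c' b').
Proof.
split=> k u v w; rewrite /tmul_pure scaler_sumr -big_split /=;
  apply: eq_bigr => i _; rewrite scaler_sumr -big_split /=;
  apply: eq_bigr => j _.
- rewrite hcomp_linear mulrDr -superAr tpureDl scalerDr !scalerA.
  by rewrite [k * _]mulrC.
- by rewrite mulrDr -superAr tpureDr scalerDr !scalerA [k * _]mulrC.
Qed.

Lemma bilin_tmul (y : tprod) : bilin (fun c' b' => tlift (tmul_pure c' b') y).
Proof.
split=> k u v w; apply: tlift_lin => c b;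
  rewrite /tmul_pure scaler_sumr -big_split /=;
  apply: eq_bigr => i _; rewrite scaler_sumr -big_split /=;
  apply: eq_bigr => j _.
- by rewrite mulrDl -superAl tpureDl scalerDr !scalerA [k * _]mulrC.
- rewrite hcomp_linear mulrDl -superAl tpureDr scalerDr !scalerA.
  by rewrite [k * _]mulrC.
Qed.

Lemma tmul_linl k x x' y : tmul (k *: x + x') y = k *: tmul x y + tmul x' y.
Proof. by rewrite Pilot.Defs.tmul.unlock; exact: (tlift_linear (bilin_tmul y)). Qed.

Lemma tmul_linr k x y y' : tmul x (k *: y + y') = k *: tmul x y + tmul x y'.
Proof.
by rewrite Pilot.Defs.tmul.unlock; apply: tlift_lin => a b; exact: (tlift_linear (bilin_tmul_pure a b)).
Qed.

Lemma tmul0l y : tmul 0 y = 0.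
Proof.
have := tmul_linl 1 0 0 y; rewrite !scale1r addr0 => /(congr1 (fun t => t - tmul 0 y)).
by rewrite subrr addrK.
Qed.

Lemma tmul0r x : tmul x 0 = 0.
Proof.
have := tmul_linr 1 x 0 0; rewrite !scale1r addr0 => /(congr1 (fun t => t - tmul x 0)).
by rewrite subrr addrK.
Qed.

Lemma tmulZl k x y : tmul (k *: x) y = k *: tmul x y.
Proof. by have := tmul_linl k x 0 y; rewrite tmul0l !addr0. Qed.

Lemma tmulZr k x y : tmul x (k *: y) = k *: tmul x y.
Proof. by have := tmul_linr k x y 0; rewrite tmul0r !addr0. Qed.

Lemma tmul_pureE c' b' c b :
  tmul (tpure c' b') (tpure c b) = tmul_pure c' b' c b.
Proof.
by rewrite Pilot.Defs.tmul.unlock (tliftE _ _ (bilin_tmul _)) (tliftE _ _ (bilin_tmul_pure _ _)).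
Qed.

Lemma tmul_homog i j c' b' c b : homog i b' -> homog j c ->
  tmul (tpure c' b') (tpure c b) = tsign i j *: tpure (c' * c) (b' * b).
Proof.
move=> hb hc; rewrite tmul_pureE /tmul_pure !big_bool.
rewrite !(hcomp_hom _ hb) !(hcomp_hom _ hc).
by case: i {hb}; case: j {hc}; rewrite /= ?mul0r ?mulr0 ?tpure0l ?tpure0r
  ?scaler0 ?addr0 ?add0r.
Qed.

Lemma tprod_hind (P : tprod -> Prop) :
  P 0 -> (forall k x y, P x -> P y -> P (k *: x + y)) ->
  (forall i j a b, homog i a -> homog j b -> P (tpure a b)) -> forall x, P x.
Proof.
move=> h0 hlin hp; have hD x y : P x -> P y -> P (x + y).
  by move=> hx hy; rewrite -[x]scale1r; apply: hlin.
apply: tprod_ind => // a b.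
rewrite -(hcomp_sum a) -(hcomp_sum b) !tpureDDl !tpureDDr.
by apply: (hD); apply: (hD); apply: hp; exact: homog_comp.
Qed.

Lemma tsignA i j k l :
  tsign i j * tsign (i (+) k) l = tsign k l * tsign i (j (+) l).
Proof.
by case: i; case: j; case: k; case: l;
  rewrite /tsign /= ?(expr0, expr1, mulr1, mul1r, mulrNN).
Qed.

Fact tmulA : associative tmul.
Proof.
move=> x y z.
elim/tprod_hind: x => [|k x x' hx hx'|i i' a b ha hb].
- by rewrite !tmul0l.
- by rewrite !tmul_linl hx hx'.
elim/tprod_hind: y => [|k y y' hy hy'|j j' a' b' ha' hb'].
- by rewrite tmul0l !tmul0r tmul0l.
- by rewrite tmul_linl !tmul_linr tmul_linl hy hy'.
elim/tprod_hind: z => [|k z z' hz hz'|l l' a'' b'' ha'' hb''].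
- by rewrite !tmul0r.
- by rewrite !tmul_linr hz hz'.
rewrite (tmul_homog _ _ hb' ha'') (tmul_homog _ _ hb ha') tmulZl tmulZr.
rewrite (tmul_homog _ _ hb (homogM ha' ha'')) (tmul_homog _ _ (homogM hb hb') ha'').
by rewrite !scalerA tsignA !mulrA.
Qed.

Fact tmul1 : left_id tone tmul.
Proof.
elim/tprod_hind => [|k y y' hy hy'|j j' a b ha hb].
- exact: tmul0r.
- by rewrite tmul_linr hy hy'.
- by rewrite (tmul_homog _ _ (homog1 B) ha) !mul1r scale1r.
Qed.

Fact tmulr1 : right_id tone tmul.
Proof.
elim/tprod_hind => [|k y y' hy hy'|j j' a b ha hb].
- exact: tmul0l.
- by rewrite tmul_linl hy hy'.
- by rewrite (tmul_homog _ _ hb (homog1 A)) !mulr1 /tsign andbF scale1r.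
Qed.

Fact tmulDl : left_distributive tmul +%R.
Proof. by move=> x y z; have := tmul_linl 1 x y z; rewrite !scale1r. Qed.

Fact tmulDr : right_distributive tmul +%R.
Proof. by move=> x y z; have := tmul_linr 1 x y z; rewrite !scale1r. Qed.

HB.instance Definition _ := GRing.Zmodule_isPzRing.Build tprod
  tmulA tmul1 tmulr1 tmulDl tmulDr.

Fact tscaleAl k (x y : tprod) : k *: (x * y) = (k *: x) * y.
Proof. by rewrite [RHS]tmulZl. Qed.

Fact tscaleAr k (x y : tprod) : k *: (x * y) = x * (k *: y).
Proof. by rewrite [RHS]tmulZr. Qed.

Lemma bilin_tcomp d :
  bilin (fun (a : A) (b : B) => \sum_(i : bool) tpure (hcomp i a) (hcomp (d (+) i) b)).
Proof.
by split=> k u v w; rewrite scaler_sumr -big_split /=; apply: eq_bigr => i _;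
  rewrite hcomp_linear ?tpureDl ?tpureDr.
Qed.

Fact tcomp_linear d k (x y : tprod) :
  tcomp d (k *: x + y) = k *: tcomp d x + tcomp d y.
Proof. by rewrite Pilot.Defs.tcomp.unlock; exact: (tlift_linear (bilin_tcomp d)). Qed.

Lemma tcomp0 d : tcomp d 0 = 0.
Proof.
have := tcomp_linear d 1 0 0; rewrite !scale1r addr0 => /(congr1 (fun t => t - tcomp d 0)).
by rewrite subrr addrK.
Qed.

Lemma tcomp_homog d i j a b : homog i a -> homog j b ->
  tcomp d (tpure a b) = if d == i (+) j then tpure a b else 0.
Proof.
move=> ha hb; rewrite Pilot.Defs.tcomp.unlock (tliftE _ _ (bilin_tcomp d)) big_bool.
rewrite !(hcomp_hom _ ha) !(hcomp_hom _ hb).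
by case: d; case: i {ha}; case: j {hb};
  rewrite /= ?tpure0l ?tpure0r ?addr0 ?add0r.
Qed.

Fact tcomp_sum (x : tprod) : tcomp false x + tcomp true x = x.
Proof.
elim/tprod_hind: x => [|k x y hx hy|i j a b ha hb].
- by rewrite !tcomp0 addr0.
- by rewrite !tcomp_linear addrACA -scalerDr hx hy.
- rewrite !(tcomp_homog _ ha hb).
  by case: (i (+) j); rewrite /= ?addr0 ?add0r.
Qed.

Fact tcomp_comp d d' (x : tprod) :
  tcomp d (tcomp d' x) = if d == d' then tcomp d x else 0.
Proof.
elim/tprod_hind: x => [|k x y hx hy|i j a b ha hb].
- by rewrite !tcomp0 if_same.
- rewrite !tcomp_linear hx hy.
  by case: ifP => _; rewrite ?scaler0 ?addr0.
- rewrite (tcomp_homog d' ha hb) (tcomp_homog d ha hb).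
  have [->|ne] := eqVneq d' (i (+) j); first by rewrite (tcomp_homog d ha hb); case: (d == _).
  by rewrite tcomp0; case: (d =P d') => // ->; rewrite (negPf ne).
Qed.

Fact tcomp1 : tcomp false (1 : tprod) = 1.
Proof. by rewrite (tcomp_homog false (homog1 A) (homog1 B)). Qed.

Fact tcompM d d' (x y : tprod) :
  tcomp (d (+) d') (tcomp d x * tcomp d' y) = tcomp d x * tcomp d' y.
Proof.
elim/tprod_hind: x => [|k x x' hx hx'|i i' a b ha hb].
- by rewrite tcomp0 mul0r tcomp0.
- by rewrite tcomp_linear mulrDl -tscaleAl tcomp_linear hx hx'.
elim/tprod_hind: y => [|k y y' hy hy'|j j' a' b' ha' hb'].
- by rewrite tcomp0 mulr0 tcomp0.
- by rewrite [tcomp d' _]tcomp_linear mulrDr -tscaleAr tcomp_linear hy hy'.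
rewrite (tcomp_homog _ ha hb) (tcomp_homog _ ha' hb').
case: eqP => [->|_]; last by rewrite mul0r tcomp0.
case: eqP => [->|_]; last by rewrite mulr0 tcomp0.
have -> : tpure a b * tpure a' b' = tsign i' j *: tpure (a * a') (b * b').
  exact: tmul_homog.
rewrite -[_ *: _]addr0 tcomp_linear tcomp0.
rewrite (tcomp_homog _ (homogM ha ha') (homogM hb hb')).
by rewrite addbACA eqxx.
Qed.

Definition tensor : superAlgebra K :=
  @SuperAlgebra K tprod *:%R (@scalerA K tprod) (@scale1r K tprod)
    (@scalerDr K tprod) (@scalerDl K tprod) tscaleAl tscaleAr
    tcomp tcomp_linear tcomp_sum tcomp_comp tcomp1 tcompM.

Definition tens (a : A) (b : B) : tensor := tpure a b.

Lemma tensM i j c' b' c b : homog i b' -> homog j c ->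
  tens c' b' * tens c b = (-1) ^+ (i && j) *: tens (c' * c) (b' * b).
Proof. exact: tmul_homog. Qed.

End TensorTheory.

Section Clifford.
Variables (K : comNzRingType) (n : nat).

Local Notation F := (free_superalg K (fun _ : 'I_n => true)).
Local Notation c := (@fvar K 'I_n (fun _ => true)).

Inductive clifford_rel : F -> F -> Prop :=
| cl_c2 i : clifford_rel (c i ^+ 2) 1
| cl_cc i j of i != j : clifford_rel (c i * c j) (- (c j * c i)).

Lemma clifford_rel_homog l r : clifford_rel l r -> exists b, homog b (l - r).
Proof.
have hc i : homog true (c i) := homog_fvar K (fun _ => true) i.
case=> [i|i j _]; exists false; apply: homogB; try exact: homog1;
  by [exact: homogM (hc _) (hc _) | apply: homogN; exact: homogM (hc _) (hc _)].
Qed.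

Definition clifford : superAlgebra K := quot_superalg clifford_rel_homog.

Definition cl_c (i : 'I_n) : clifford := quot_pi clifford_rel_homog (c i).

End Clifford.

Inductive hc_gen (n : nat) :=
| HX of 'I_n | HY of 'I_n | HC of 'I_n | HS of 'S_n.

Section HcGen.
Variable n : nat.
Definition hc_gen_code (g : hc_gen n) : 'I_n + 'I_n + ('I_n + 'S_n) :=
  match g with
  | HX i => inl (inl i) | HY i => inl (inr i)
  | HC i => inr (inl i) | HS s => inr (inr s)
  end.
Definition hc_gen_decode (g : 'I_n + 'I_n + ('I_n + 'S_n)) : hc_gen n :=
  match g with
  | inl (inl i) => HX i | inl (inr i) => HY i
  | inr (inl i) => HC i | inr (inr s) => HS s
  end.
Lemma hc_gen_codeK : cancel hc_gen_code hc_gen_decode. Proof. by case. Qed.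
HB.instance Definition _ := Choice.copy (hc_gen n) (can_type hc_gen_codeK).
End HcGen.

Definition hc_odd (n : nat) (g : hc_gen n) : bool :=
  if g is HC _ then true else false.

Section RationalDAHCa.
Variables (K : comNzRingType) (n : nat) (u : K).

Local Notation F := (free_superalg K (@hc_odd n)).
Local Notation var := (@fvar K (hc_gen n) (@hc_odd n)).
Local Notation x i := (var (HX i)).
Local Notation y i := (var (HY i)).
Local Notation c i := (var (HC i)).
Local Notation s w := (var (HS w)).

(* Permutations act on indices from the left, so the product of v and w in S_n
   is their composite v \o w, which the library writes (w * v)%g. *)
Inductive hc_rel : F -> F -> Prop :=
| hc_s1 : hc_rel (s 1%g) 1
| hc_ss v w : hc_rel (s v * s w) (s (w * v)%g)
| hc_xx i j : hc_rel (x i * x j) (x j * x i)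
| hc_yy i j : hc_rel (y i * y j) (y j * y i)
| hc_sx w i : hc_rel (s w * x i) (x (w i) * s w)
| hc_sy w i : hc_rel (s w * y i) (y (w i) * s w)
| hc_sc w i : hc_rel (s w * c i) (c (w i) * s w)
| hc_cx i : hc_rel (c i * x i) (- (x i * c i))
| hc_cy i : hc_rel (c i * y i) (y i * c i)
| hc_cx_ne i j of i != j : hc_rel (c j * x i) (x i * c j)
| hc_cy_ne i j of i != j : hc_rel (c j * y i) (y i * c j)
| hc_c2 i : hc_rel (c i ^+ 2) 1
| hc_cc i j of i != j : hc_rel (c i * c j) (- (c j * c i))
| hc_yx_ne i j of i != j :
    hc_rel (y j * x i - x i * y j) (u *: ((1 + c j * c i) * s (tperm i j)))
| hc_yx i :
    hc_rel (y i * x i - x i * y i)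
           (- (u *: \sum_(k | k != i) (1 + c k * c i) * s (tperm k i))).

Lemma hc_rel_homog l r : hc_rel l r -> exists b, homog b (l - r).
Proof.
have hx i : homog false (x i) := homog_fvar K (@hc_odd n) (HX i).
have hy i : homog false (y i) := homog_fvar K (@hc_odd n) (HY i).
have hc i : homog true (c i) := homog_fvar K (@hc_odd n) (HC i).
have hs w : homog false (s w) := homog_fvar K (@hc_odd n) (HS w).
have hccs i j w : homog false ((1 + c i * c j) * s w).
  by apply: (homogM (b := false) (b' := false)) => //; apply: homogD;
    [exact: homog1|exact: homogM (hc _) (hc _)].
have hcomm i j : homog false (y j * x i - x i * y j).
  exact: homogB (homogM (hy _) (hx _)) (homogM (hx _) (hy _)).
case=> [|v w|i j|i j|w i|w i|w i|i|i|i j _|i j _|i|i j _|i j _|i].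
- by exists false; apply: homogB => //; exact: homog1.
- by exists false; exact: homogB (homogM (hs _) (hs _)) (hs _).
- by exists false; exact: homogB (homogM (hx _) (hx _)) (homogM (hx _) (hx _)).
- by exists false; exact: homogB (homogM (hy _) (hy _)) (homogM (hy _) (hy _)).
- by exists false; exact: homogB (homogM (hs _) (hx _)) (homogM (hx _) (hs _)).
- by exists false; exact: homogB (homogM (hs _) (hy _)) (homogM (hy _) (hs _)).
- by exists true; exact: homogB (homogM (hs _) (hc _)) (homogM (hc _) (hs _)).
- by exists true; exact: homogB (homogM (hc _) (hx _))
                               (homogN (homogM (hx _) (hc _))).
- by exists true; exact: homogB (homogM (hc _) (hy _)) (homogM (hy _) (hc _)).
- by exists true; exact: homogB (homogM (hc _) (hx _)) (homogM (hx _) (hc _)).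
- by exists true; exact: homogB (homogM (hc _) (hy _)) (homogM (hy _) (hc _)).
- by exists false; exact: homogB (homogM (hc _) (hc _)) (homog1 _).
- by exists false; exact: homogB (homogM (hc _) (hc _))
                                (homogN (homogM (hc _) (hc _))).
- by exists false; exact: homogB (hcomm _ _) (homogZ _ (hccs _ _ _)).
- exists false; apply: homogB => //; apply: homogN; apply: homogZ.
  by apply: homog_sum => k _.
Qed.

Definition rational_DAHCa : superAlgebra K := quot_superalg hc_rel_homog.

Definition hc_x (i : 'I_n) : rational_DAHCa := quot_pi hc_rel_homog (x i).
Definition hc_y (i : 'I_n) : rational_DAHCa := quot_pi hc_rel_homog (y i).
Definition hc_c (i : 'I_n) : rational_DAHCa := quot_pi hc_rel_homog (c i).
Definition hc_s (w : 'S_n) : rational_DAHCa := quot_pi hc_rel_homog (s w).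

End RationalDAHCa.

(* For k : 'I_n.-1, the indices k and k + 1 exchanged by the k-th simple
   transposition. *)
Lemma idxr_subproof (n : nat) (k : 'I_n.-1) : (k.+1 < n)%N.
Proof. by rewrite -ltn_predRL. Qed.
Definition idxl (n : nat) (k : 'I_n.-1) : 'I_n := widen_ord (leq_pred n) k.
Definition idxr (n : nat) (k : 'I_n.-1) : 'I_n := Ordinal (idxr_subproof k).

Inductive sp_gen (n : nat) := SXi of 'I_n | SY of 'I_n | ST of 'I_n.-1.

Section SpGen.
Variable n : nat.
Definition sp_gen_code (g : sp_gen n) : 'I_n + 'I_n + 'I_n.-1 :=
  match g with SXi i => inl (inl i) | SY i => inl (inr i) | ST k => inr k end.
Definition sp_gen_decode (g : 'I_n + 'I_n + 'I_n.-1) : sp_gen n :=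
  match g with inl (inl i) => SXi i | inl (inr i) => SY i | inr k => ST k end.
Lemma sp_gen_codeK : cancel sp_gen_code sp_gen_decode. Proof. by case. Qed.
HB.instance Definition _ := Choice.copy (sp_gen n) (can_type sp_gen_codeK).
End SpGen.

Definition sp_odd (n : nat) (g : sp_gen n) : bool :=
  if g is SY _ then false else true.

Section RationalSpinDAHA.
Variables (K : comNzRingType) (n : nat) (u : K).

Local Notation F := (free_superalg K (@sp_odd n)).
Local Notation var := (@fvar K (sp_gen n) (@sp_odd n)).
Local Notation xi i := (var (SXi i)).
Local Notation y i := (var (SY i)).
Local Notation t k := (var (ST k)).

(* t_{j-1} ... t_{i+1} t_i t_{i+1} ... t_{j-1}, for i < j *)
Definition tword (i j : 'I_n) : F :=
  (\prod_(k <- rev (enum 'I_n.-1) | (i < k < j)%N) t k) *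
  (\prod_(k <- enum 'I_n.-1 | (i <= k < j)%N) t k).

(* The element [i, j], for i != j. *)
Definition tbracket (i j : 'I_n) : F :=
  if (i < j)%N then (-1) ^+ (j - i - 1) * tword i j
  else - ((-1) ^+ (i - j - 1) * tword j i).

Inductive sp_rel : F -> F -> Prop :=
| sp_t2 k : sp_rel (t k ^+ 2) 1
| sp_braid (k l : 'I_n.-1) of l = k.+1 :> nat :
    sp_rel (t k * t l * t k) (t l * t k * t l)
| sp_tt (k l : 'I_n.-1) of (k.+1 < l)%N || (l.+1 < k)%N :
    sp_rel (t k * t l) (- (t l * t k))
| sp_xixi i j of i != j : sp_rel (xi i * xi j) (- (xi j * xi i))
| sp_yy i j of i != j : sp_rel (y i * y j) (y j * y i)
| sp_txi k : sp_rel (t k * xi (idxl k)) (- (xi (idxr k) * t k))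
| sp_ty k : sp_rel (t k * y (idxl k)) (y (idxr k) * t k)
| sp_txi_ne k i of i != idxl k & i != idxr k :
    sp_rel (t k * xi i) (- (xi i * t k))
| sp_ty_ne k i of i != idxl k & i != idxr k :
    sp_rel (t k * y i) (y i * t k)
| sp_yxi_ne i j of i != j :
    sp_rel (y i * xi j - xi j * y i) (u *: tbracket i j)
| sp_yxi i :
    sp_rel (y i * xi i - xi i * y i) (u *: \sum_(k | k != i) tbracket i k).

Lemma homog_tword (i j : 'I_n) : (i < j)%N -> homog true (tword i j).
Proof.
move=> ltij.
have ht k : homog true (t k) := homog_fvar K (@sp_odd n) (ST k).
have hp (e : seq 'I_n.-1) (P : pred 'I_n.-1) :
    homog (odd (count P e)) (\prod_(k <- e | P k) t k : F).
  elim: e => [|k e IH]; first by rewrite big_nil; exact: homog1.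
  rewrite big_cons /=; case: ifP => _ //.
  by rewrite oddD; exact: homogM (ht k) IH.
have lti : (i < n.-1)%N.
  by rewrite ltn_predRL; apply: leq_ltn_trans (ltn_ord j).
pose i' := Ordinal lti; pose P2 (k : 'I_n.-1) := (i <= k < j)%N.
have e : count P2 (enum 'I_n.-1)
       = (count (fun k : 'I_n.-1 => (i < k < j)%N) (enum 'I_n.-1)).+1.
  have hcard (P : pred 'I_n.-1) : count P (enum 'I_n.-1) = #|P|.
    by rewrite cardE [in RHS]/enum_mem size_filter enumT.
  rewrite !hcard (cardD1 i') /in_mem /= {1}/P2 /= leqnn ltij add1n; congr _.+1.
  apply: eq_card => k; rewrite !inE /in_mem /= /P2 -val_eqE /=.
  by rewrite eq_sym andbA -ltn_neqAle.
have := homogM (hp (rev (enum 'I_n.-1)) (fun k : 'I_n.-1 => (i < k < j)%N))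
               (hp (enum 'I_n.-1) P2).
by rewrite count_rev e /= addbN addbb.
Qed.

Lemma homog_tbracket i j : i != j -> homog true (tbracket i j).
Proof.
have hs k z : homog true z -> homog true ((-1) ^+ k * z : F).
  by rewrite -signr_odd mulr_sign; case: ifP => // _; exact: homogN.
rewrite /tbracket => ne; case: ltngtP => [lt|lt|/ord_inj eq].
- by apply: hs; exact: homog_tword.
- by apply: homogN; apply: hs; exact: homog_tword.
- by rewrite eq eqxx in ne.
Qed.

Lemma sp_rel_homog l r : sp_rel l r -> exists b, homog b (l - r).
Proof.
have hxi i : homog true (xi i) := homog_fvar K (@sp_odd n) (SXi i).
have hy i : homog false (y i) := homog_fvar K (@sp_odd n) (SY i).
have ht k : homog true (t k) := homog_fvar K (@sp_odd n) (ST k).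
have hcomm i j : homog true (y i * xi j - xi j * y i).
  exact: homogB (homogM (hy _) (hxi _)) (homogM (hxi _) (hy _)).
case=> [k|k l' _|k l' _|i j _|i j _|k|k|k i _ _|k i _ _|i j ne|i].
- by exists false; exact: homogB (homogM (ht _) (ht _)) (homog1 _).
- by exists true; exact: homogB (homogM (homogM (ht _) (ht _)) (ht _))
                               (homogM (homogM (ht _) (ht _)) (ht _)).
- by exists false; exact: homogB (homogM (ht _) (ht _))
                                (homogN (homogM (ht _) (ht _))).
- by exists false; exact: homogB (homogM (hxi _) (hxi _))
                                (homogN (homogM (hxi _) (hxi _))).
- by exists false; exact: homogB (homogM (hy _) (hy _)) (homogM (hy _) (hy _)).
- by exists false; exact: homogB (homogM (ht _) (hxi _))
                                (homogN (homogM (hxi _) (ht _))).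
- by exists true; exact: homogB (homogM (ht _) (hy _)) (homogM (hy _) (ht _)).
- by exists false; exact: homogB (homogM (ht _) (hxi _))
                                (homogN (homogM (hxi _) (ht _))).
- by exists true; exact: homogB (homogM (ht _) (hy _)) (homogM (hy _) (ht _)).
- by exists true; exact: homogB (hcomm _ _) (homogZ _ (homog_tbracket ne)).
- exists true; apply: homogB => //; apply: homogZ; apply: homog_sum => k ne.
  by apply: homog_tbracket; rewrite eq_sym.
Qed.

Definition rational_spin_DAHA : superAlgebra K := quot_superalg sp_rel_homog.

Definition sp_xi (i : 'I_n) : rational_spin_DAHA := quot_pi sp_rel_homog (xi i).
Definition sp_y (i : 'I_n) : rational_spin_DAHA := quot_pi sp_rel_homog (y i).
Definition sp_t (k : 'I_n.-1) : rational_spin_DAHA := quot_pi sp_rel_homog (t k).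

End RationalSpinDAHA.

(* Main.v *)
From Pilot Require Import Defs.
From mathcomp Require Import all_boot all_algebra all_fingroup.
From mathcomp Require Import reals.
From mathcomp.real_closed Require Import complex.
From mathcomp Require Import finmap.
From mathcomp.multinomials Require Import monalg.
From mathcomp Require Import zify.

Set Implicit Arguments.
Unset Strict Implicit.
Unset Printing Implicit Defensive.

Import GRing.Theory.
Local Open Scope ring_scope.

(** Write [a_k = c_k - c_(k+1)].  In any superalgebra where the [c_i] satisfy
    the Clifford relations, [a_k ^+ 2 = 2], so [b_k = rt^-1 a_k] is odd with
    square [-1].  Multiplying by [b_k] turns elements [t_k] that supercommute
    with the [c_i] into elements [s_k = b_k t_k] that permute the [c_i], and
    [t_k = - b_k s_k] undoes this.  In the same way [x_i = rt c_i xi_i]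
    corresponds to [xi_i = rt^-1 c_i x_i].  Every relation of the spin algebra,
    read together with supercommutation with the [c_i], is equivalent under this
    dictionary to a relation of the Hecke-Clifford algebra, because the [a_k] and
    the [c_i] can be cancelled: see [twist_sqr], [twist_braid], [twist_comm],
    [twist_odd], [twist_even], [X_comm], [Y_X_neq], [Y_X_diag].  The last two
    rest on [twist_tperm], which identifies the transposition [(i j)] with
    [rt^-1 (c_i - c_j) [i, j]].

    Both algebras and their tensor product are known through universal
    properties ([presented_lift], [tensor_lift]), so the dictionary yields
    algebra maps in both directions, and these are mutually inverse because they
    are so on generators ([dahca_tensor_iso]).

    One ingredient is not formal.  The Hecke-Clifford algebra contains a symbol
    for every permutation, while the dictionary only provides the images of the
    simple transpositions.  That these extend to all of the symmetric group is
    its Coxeter presentation, proved here by building the image of [w] one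
    descent at a time: two descents of [w] lead to the same element either
    because they are far apart and commute, or by the braid relation
    ([cox_descent]). *)

(** * Linear maps, homogeneous products, evaluation of free superalgebras *)

Lemma superalg_morph_comp (K : comNzRingType) (A B D : superAlgebra K)
    (f : A -> B) (g : B -> D) :
  superalg_morph f -> superalg_morph g -> superalg_morph (g \o f).
Proof.
move=> [lf [f1 fM] hf] [lg [g1 gM] hg]; split=> /=.
- by move=> k x y /=; rewrite lf lg.
- by split=> [|x y] /=; rewrite ?f1 ?fM.
- by move=> b x /hf; exact: hg.
Qed.

Lemma homog_prod (K : comNzRingType) (A : superAlgebra K) (I : Type)
    (p : pred I) (F : I -> A) (w : seq I) :
  (forall i, homog (p i) (F i)) ->
  homog (odd (count p w)) (\prod_(i <- w) F i).
Proof.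
move=> hF; elim: w => [|i w IH]; first by rewrite big_nil; exact: homog1.
by rewrite big_cons /= oddD oddb; exact: homogM.
Qed.

Section LinearMap.
Variables (K : comNzRingType) (A B : superAlgebra K) (f : A -> B).
Hypothesis lf : linear f.

Lemma linmapD x y : f (x + y) = f x + f y.
Proof. by have := lf 1 x y; rewrite !scale1r. Qed.

Lemma linmap0 : f 0 = 0.
Proof. by apply: (addIr (f 0)); rewrite -linmapD !add0r. Qed.

Lemma linmapZ k x : f (k *: x) = k *: f x.
Proof. by have := lf k x 0; rewrite linmap0 !addr0. Qed.

Lemma linmapN x : f (- x) = - f x.
Proof. by rewrite -scaleN1r linmapZ scaleN1r. Qed.

Lemma linmap_sum (I : Type) (r : seq I) (P : pred I) (F : I -> A) :
  f (\sum_(i <- r | P i) F i) = \sum_(i <- r | P i) f (F i).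
Proof. exact: (big_morph f linmapD linmap0). Qed.

End LinearMap.

Section FreeEvaluation.
Variables (K : comNzRingType) (G : choiceType) (p : G -> bool).
Variables (D : superAlgebra K) (phi : G -> D).

Local Notation F := {malg K[{fmonom G}]}.
Local Notation free := (free_superalg K p).

Definition free_ev (f : free) : D :=
  \sum_(m <- msupp (f : F)) (f : F)@_m *: \prod_(g <- (m : {fmonom G})) phi g.

Lemma free_evEw (d : {fset {fmonom G}}) (f : F) : (msupp f `<=` d)%fset ->
  free_ev f = \sum_(m <- d) f@_m *: \prod_(g <- m) phi g.
Proof.
move=> le; rewrite [LHS](big_fset_incl _ le) => //= m _ /mcoeff_outdom ->.
by rewrite scale0r.
Qed.

Lemma free_ev_linear : linear free_ev.
Proof.
move=> k x y; set X : F := x; set Y : F := y.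
pose d := (msupp X `|` msupp Y `|` msupp (k *: X + Y))%fset.
rewrite [LHS](@free_evEw d (k *: X + Y)) ?fsubsetUr //.
rewrite (@free_evEw d X); last by rewrite /d -fsetUA fsubsetUl.
rewrite (@free_evEw d Y); last by rewrite /d fsetUAC fsubsetUr.
rewrite scaler_sumr -big_split /=; apply: eq_bigr => m _.
by rewrite mcoeffD mcoeffZ scalerDl scalerA.
Qed.

Lemma free_evU (m : {fmonom G}) : free_ev (<< m >> : F) = \prod_(g <- m) phi g.
Proof.
by rewrite /free_ev msuppU oner_eq0 big_seq_fset1 mcoeffUU scale1r.
Qed.

Lemma free_ev_var g : free_ev (fvar K p g) = phi g.
Proof. by rewrite free_evU fmuE big_seq1. Qed.

Lemma free_ind (P : free -> Prop) :
  P 0 -> (forall k x y, P x -> P y -> P (k *: x + y)) ->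
  (forall m : {fmonom G}, P (<< m >> : F)) -> forall x, P x.
Proof.
move=> h0 hlin hm x; rewrite (monalgE (x : F)).
elim: (enum_fset _) => [|m r IH]; first by rewrite big_nil.
rewrite big_cons.
have -> : << (x : F)@_m *g m >> = (x : F)@_m *: << m >> :> F.
  by apply/malgP => q; rewrite mcoeffZ !mcoeffU mulr_natr.
exact: hlin.
Qed.

Lemma free_monomM (m m' : {fmonom G}) :
  (<< m >> : F) * << m' >> = << mmul m m' >>.
Proof. by rewrite malgM_def fgmulUU mulr1. Qed.

Lemma free_monom_prod (m : {fmonom G}) :
  (<< m >> : F) = \prod_(g <- m) fvar K p g :> free.
Proof.
case: m; elim=> [|g w IH] /=; first by rewrite big_nil -fmoneE.
rewrite big_cons -IH; apply: etrans (esym (free_monomM (fmu g) (FMonom w))).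
by congr << _ >>; apply/eqP; rewrite fmP fmM fmuE.
Qed.

Lemma free_ev_morph : monoid_morphism free_ev.
Proof.
split=> [|x y]; first by rewrite [LHS](free_evU mone) fm1 big_nil.
elim/free_ind: x => [|k x x' hx hx'|m].
- by rewrite mul0r (linmap0 free_ev_linear) mul0r.
- rewrite mulrDl -superAl !free_ev_linear hx hx' mulrDl.
  by rewrite superAl.
elim/free_ind: y => [|k y y' hy hy'|m'].
- by rewrite mulr0 (linmap0 free_ev_linear) mulr0.
- by rewrite mulrDr -superAr !free_ev_linear hy hy' mulrDr superAr.
by rewrite [LHS](congr1 free_ev (free_monomM m m')) !free_evU fmM big_cat.
Qed.

End FreeEvaluation.

(** * Presented superalgebras and tensor products *)

Section Presented.
Variables (K : comNzRingType) (G : choiceType) (p : G -> bool).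
Variable rel : free_superalg K p -> free_superalg K p -> Prop.
Hypothesis rel_homog : forall l r, rel l r -> exists b, homog b (l - r).

Local Notation Q := (quot_superalg rel_homog).

Definition pgen (g : G) : Q := quot_pi rel_homog (fvar K p g).
Definition pword (w : seq G) : Q := \prod_(g <- w) pgen g.

Lemma homog_pgen g : homog (p g) (pgen g).
Proof. by have [_ _ h] := quot_pi_morph rel_homog; apply: h; exact: homog_fvar. Qed.

Lemma homog_pword w : homog (odd (count p w)) (pword w).
Proof. exact: homog_prod homog_pgen. Qed.

(** Words span because monomials span the free algebra.  They are homogeneous,
    so statements about the grading reduce to words as well. *)
Lemma presented_ind (P : Q -> Prop) :
  P 0 -> (forall k x y, P x -> P y -> P (k *: x + y)) ->
  (forall w, P (pword w)) -> forall x, P x.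
Proof.
have [lpi [pi1 piM] _] := quot_pi_morph rel_homog.
move=> h0 hlin hw x; have [f ->] := quot_pi_surj x.
elim/free_ind: f => [|k f f' hf hf'|m].
- by rewrite (linmap0 lpi).
- by rewrite lpi; exact: hlin.
rewrite [X in quot_pi _ X]free_monom_prod.
by rewrite (big_morph (quot_pi rel_homog) piM pi1); exact: hw.
Qed.

Section Morphisms.
Variable D : superAlgebra K.

(** Evaluation at [phi] annihilates the two-sided ideal of the relators, being
    multiplicative.  It respects parity because a word and its value have the
    same one. *)
Lemma presented_lift (phi : G -> D) :
  (forall g, homog (p g) (phi g)) ->
  (forall l r, rel l r -> free_ev phi l = free_ev phi r) ->
  exists2 f : Q -> D, superalg_morph f & forall g, f (pgen g) = phi g.
Proof.
move=> hphi hrel; pose ev := @free_ev K G p D phi.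
have lev : linear ev := @free_ev_linear K G p D phi.
have [ev1 evM] : monoid_morphism ev := @free_ev_morph K G p D phi.
have evB x y : ev (x - y) = ev x - ev y.
  by rewrite (linmapD lev) (linmapN lev).
have ev_span x : Pilot.Defs.span (@ideal_gen _ _ rel) x -> ev x = 0.
  elim=> {x} [_ [a c l r /hrel h]||k u v _ hu _ hv].
  - by rewrite !evM evB [ev l]h subrr mulr0 mul0r.
  - exact: linmap0.
  - by rewrite lev hu hv scaler0 addr0.
pose f (x : Q) : D := ev (@qrepr K _ (@ideal_gen _ _ rel) x).
have fE x : f (quot_pi rel_homog x) = ev x.
  by apply/eqP; rewrite -subr_eq0 -evB ev_span //; exact: qpi_qrepr.
have [lpi [pi1 piM] _] := quot_pi_morph rel_homog.
have lf : linear f.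
  move=> k x y; have [[a ->] [b ->]] := conj (quot_pi_surj x) (quot_pi_surj y).
  by rewrite -lpi !fE lev.
have fM : {morph f : x y / x * y}.
  move=> x y; have [[a ->] [b ->]] := conj (quot_pi_surj x) (quot_pi_surj y).
  by rewrite -piM !fE evM.
have f1 : f 1 = 1 by rewrite -pi1 fE ev1.
have fgen g : f (pgen g) = phi g by rewrite fE; exact: free_ev_var.
exists f => //; split=> // b x <-.
elim/presented_ind: x => [|k x y hx hy|w].
- by rewrite hcomp0 (linmap0 lf); exact: homog0.
- by rewrite hcomp_linear lf; apply: homogD hy; exact: homogZ.
rewrite (hcomp_hom _ (homog_pword w)); case: eqP => [->|_]; last first.
  by rewrite (linmap0 lf); exact: homog0.
rewrite /pword (big_morph f fM f1); apply: homog_prod => g.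
by rewrite fgen.
Qed.

Lemma presented_eq (f f' : Q -> D) :
  superalg_morph f -> superalg_morph f' ->
  (forall g, f (pgen g) = f' (pgen g)) -> f =1 f'.
Proof.
move=> [lf [f1 fM] _] [lf' [f'1 f'M] _] e x.
elim/presented_ind: x => [|k x y hx hy|w].
- by rewrite (linmap0 lf) (linmap0 lf').
- by rewrite lf lf' hx hy.
by rewrite (big_morph f fM f1) (big_morph f' f'M f'1); apply: eq_bigr.
Qed.

End Morphisms.
End Presented.

Definition supercommuting (K : comNzRingType) (A B D : superAlgebra K)
    (f : A -> D) (g : B -> D) : Prop :=
  forall i j a b, homog i a -> homog j b ->
    g b * f a = (-1) ^+ (i && j) *: (f a * g b).

Section Supercommuting.
Variables (K : comNzRingType) (G G' : choiceType) (p : G -> bool) (p' : G' -> bool).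
Variables (rel : free_superalg K p -> free_superalg K p -> Prop)
  (rel' : free_superalg K p' -> free_superalg K p' -> Prop).
Hypotheses (rel_homog : forall l r, rel l r -> exists b, homog b (l - r))
  (rel_homog' : forall l r, rel' l r -> exists b, homog b (l - r)).
Local Notation A := (quot_superalg rel_homog).
Local Notation B := (quot_superalg rel_homog').
Variables (D : superAlgebra K) (f : A -> D) (g : B -> D).

(** The sign is multiplicative in both words, so the sign rule propagates from
    generators to words, and then by bilinearity. *)
Lemma supercommuting_gen :
  superalg_morph f -> superalg_morph g ->
  (forall x y, g (pgen rel_homog' y) * f (pgen rel_homog x)
     = (-1) ^+ (p x && p' y) *: (f (pgen rel_homog x) * g (pgen rel_homog' y))) ->
  supercommuting f g.
Proof.
move=> [lf [f1 fM] hf] [lg [g1 gM] hg] hgen i j a b ha hb; rewrite -ha -hb.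
have signs (k k' l : bool) : (-1) ^+ (k && l) * (-1) ^+ (k' && l)
                             = (-1) ^+ ((k (+) k') && l) :> K.
  by case: k; case: k'; case: l; rewrite /= ?mulrNN ?mulr1 ?mul1r.
have hword y w : g (pgen rel_homog' y) * f (pword rel_homog w)
    = (-1) ^+ (odd (count p w) && p' y)
        *: (f (pword rel_homog w) * g (pgen rel_homog' y)).
  elim: w => [|x w IH]; first by rewrite /pword big_nil f1 mulr1 mul1r scale1r.
  rewrite /pword big_cons fM mulrA hgen -superAl -mulrA IH -superAr !mulrA.
  by rewrite scalerA signs /= oddD oddb.
have hwords v w : g (pword rel_homog' v) * f (pword rel_homog w)
    = (-1) ^+ (odd (count p w) && odd (count p' v))
        *: (f (pword rel_homog w) * g (pword rel_homog' v)).
  elim: v => [|y v IH].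
    by rewrite /pword big_nil g1 mulr1 mul1r andbF scale1r.
  rewrite /pword big_cons gM -mulrA IH -superAr mulrA hword -superAl -!mulrA.
  rewrite scalerA andbC [_ && p' y]andbC signs addbC andbC.
  by rewrite /= oddD oddb.
elim/presented_ind: a {ha} => [|k a a' IH IH'|w].
- by rewrite hcomp0 (linmap0 lf) mul0r mulr0 scaler0.
- rewrite hcomp_linear lf mulrDl mulrDr -superAl -superAr IH IH'.
  by rewrite scalerDr !scalerA mulrC.
elim/presented_ind: b {hb} => [|k b b' IH IH'|v].
- by rewrite hcomp0 (linmap0 lg) mul0r mulr0 scaler0.
- rewrite hcomp_linear lg mulrDl mulrDr -superAl -superAr IH IH'.
  by rewrite scalerDr !scalerA mulrC.
rewrite !(hcomp_hom _ (homog_pword _ _)).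
case: eqP => [->|_]; last by rewrite (linmap0 lg) mul0r mulr0 scaler0.
case: eqP => [->|_]; last by rewrite (linmap0 lf) mul0r mulr0 scaler0.
exact: hwords.
Qed.

End Supercommuting.

Section TensorLift.
Variables (K : comNzRingType) (A B D : superAlgebra K).

Lemma tensor_ind (P : tensor A B -> Prop) :
  P 0 -> (forall k x y, P x -> P y -> P (k *: x + y)) ->
  (forall i j a b, homog i a -> homog j b -> P (tens a b)) -> forall x, P x.
Proof. exact: tprod_hind. Qed.

Lemma tens_linl (b : B) : linear (fun a : A => tens a b).
Proof. by move=> k x y; exact: tpureDl. Qed.

Lemma tens_linr (a : A) : linear (tens a : B -> _).
Proof. by move=> k x y; exact: tpureDr. Qed.

Lemma homog_tens i j (a : A) (b : B) :
  homog i a -> homog j b -> homog (i (+) j) (tens a b).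
Proof. by move=> ha hb; apply: etrans (tcomp_homog _ ha hb) _; rewrite eqxx. Qed.

Lemma tens_split (a : A) (b : B) : tens a b = tens a 1 * tens 1 b.
Proof.
rewrite -(hcomp_sum b) !(linmapD (tens_linr _)) mulrDr.
by rewrite !(tensM _ _ (homog1 B) (homog1 A)) !scale1r !mulr1 !mul1r.
Qed.

Lemma tens_left_morph : superalg_morph (fun a : A => tens a 1 : tensor A B).
Proof.
split; first exact: tens_linl.
- split=> // x y; rewrite -(hcomp_sum y) mulrDr !(linmapD (tens_linl _)) mulrDr.
  by rewrite !(tensM _ _ (homog1 B) (homog_comp _ _)) !scale1r !mulr1.
- by move=> b x hx; rewrite -[b]addbF; apply: homog_tens hx (homog1 B).
Qed.

Lemma tens_right_morph : superalg_morph (fun b : B => tens 1 b : tensor A B).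
Proof.
split; first exact: tens_linr.
- split=> // x y; rewrite -(hcomp_sum x) mulrDl !(linmapD (tens_linr _)) mulrDl.
  by rewrite !(tensM _ _ (homog_comp _ _) (homog1 A)) !andbF !scale1r !mulr1.
- by move=> b x hx; rewrite -[b]addFb; apply: homog_tens hx; exact: homog1.
Qed.

Lemma tens_anticomm (a : A) (b : B) : homog true a -> homog true b ->
  tens 1 b * tens a 1 = - (tens a 1 * tens 1 b).
Proof.
move=> ha hb; rewrite (tensM _ _ hb ha) (tensM _ _ (homog1 B) (homog1 A)).
by rewrite !mul1r !mulr1 scaleN1r scale1r.
Qed.

Lemma tens_comm (a : A) (b : B) : homog true a -> homog false b ->
  tens 1 b * tens a 1 = tens a 1 * tens 1 b.
Proof.
move=> ha hb; rewrite (tensM _ _ hb ha) (tensM _ _ (homog1 B) (homog1 A)).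
by rewrite !mul1r !mulr1.
Qed.

(** Multiplicativity is the sign rule: in [f a * g b * (f a' * g b')] the factor
    [g b] has to move past [f a'], at the same cost as in the tensor product. *)
Lemma tensor_lift (f : A -> D) (g : B -> D) :
  superalg_morph f -> superalg_morph g -> supercommuting f g ->
  exists2 h : tensor A B -> D, superalg_morph h &
    forall a b, h (tens a b) = f a * g b.
Proof.
move=> [lf [f1 fM] hf] [lg [g1 gM] hg] hfg.
pose h := @tlift K A B D (fun a b => f a * g b).
have hbil : bilin (fun a b => f a * g b).
  split=> [k x x' y|k x y y']; first by rewrite lf mulrDl superAl.
  by rewrite lg mulrDr superAr.
have lh : linear (h : tensor A B -> D) := tlift_linear hbil.
have hE a b : h (tens a b) = f a * g b := tliftE a b hbil.
exists h => //; split=> //; first split.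
- by rewrite hE f1 g1 mulr1.
- elim/tensor_ind => [y|k x x' IH IH' y|i j a b ha hb].
  + by rewrite mul0r (linmap0 lh) mul0r.
  + by rewrite mulrDl -superAl !lh IH IH' mulrDl superAl.
  elim/tensor_ind => [|k y y' IH IH'|i' j' a' b' ha' hb'].
  + by rewrite mulr0 (linmap0 lh) mulr0.
  + by rewrite mulrDr -superAr !lh IH IH' mulrDr superAr.
  rewrite (tensM _ _ hb ha') (linmapZ lh) !hE fM gM.
  rewrite -!mulrA [g b * (f a' * _)]mulrA (hfg _ _ _ _ ha' hb) -superAl -!superAr.
  by rewrite andbC !mulrA.
- move=> d x <-.
  elim/tensor_ind: x => [|k x y hx hy|i j a b ha hb].
  + by rewrite hcomp0 (linmap0 lh); exact: homog0.
  + by rewrite hcomp_linear lh; apply: homogD hy; exact: homogZ.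
  rewrite (hcomp_hom _ (homog_tens ha hb)); case: eqP => [->|_]; last first.
    by rewrite (linmap0 lh); exact: homog0.
  by rewrite hE; apply: homogM; [exact: hf|exact: hg].
Qed.

Lemma tensor_eq (f g : tensor A B -> D) :
  superalg_morph f -> superalg_morph g ->
  (forall a, f (tens a 1) = g (tens a 1)) ->
  (forall b, f (tens 1 b) = g (tens 1 b)) -> f =1 g.
Proof.
move=> [lf [_ fM] _] [lg [_ gM] _] hl hr; elim/tensor_ind => [|k x y hx hy|i j a b _ _].
- by rewrite (linmap0 lf) (linmap0 lg).
- by rewrite lf lg hx hy.
by rewrite tens_split fM gM hl hr.
Qed.

End TensorLift.

(** * The Coxeter presentation of the symmetric group *)

Section SimpleTranspositions.
Variable n : nat.
Implicit Types (k l : 'I_n.-1) (w v : 'S_n).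

Definition simple k : 'S_n := tperm (idxl k) (idxr k).

Lemma idxlr_neq k : idxl k != idxr k.
Proof. by rewrite -val_eqE /= neq_ltn ltnSn. Qed.

Lemma simpleK k w : (simple k * (simple k * w))%g = w.
Proof. by rewrite mulgA tperm2 mul1g. Qed.

Lemma simple_braid k l : l = k.+1 :> nat ->
  (simple k * simple l * simple k = simple l * simple k * simple l)%g.
Proof.
move=> lk; have e : idxl l = idxr k by apply: val_inj.
have tpermVg (s t : 'I_n) (z : 'S_n) : (tperm s t * z * tperm s t = z ^ tperm s t)%g.
  by rewrite conjgE tpermV mulgA.
rewrite !tpermVg !tpermJ e tpermR [tperm _ (idxr l) (idxr k)]tpermL.
rewrite !tpermD // -val_eqE /= ?lk; lia.
Qed.

Lemma simple_comm k l : (k.+1 < l)%N || (l.+1 < k)%N ->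
  (simple k * simple l = simple l * simple k)%g.
Proof.
move=> kl; rewrite [RHS]conjgC tpermJ !tpermD // -val_eqE /=; lia.
Qed.

Definition descent w k := (w (idxr k) < w (idxl k))%N.

(** Exchanging the values at a descent increases this number, which plays the
    part of (minus) the number of inversions and is easier to compute with. *)
Definition weight w := (\sum_(i < n) i * w i)%N.

Lemma weight_simple k w :
  (weight (simple k * w) + w (idxr k) = weight w + w (idxl k))%N.
Proof.
have kr := idxlr_neq k.
have pair v : weight v = (k * v (idxl k) + (k.+1 * v (idxr k) +
    \sum_(i | (i != idxl k) && (i != idxr k)) i * v i))%N.
  rewrite /weight (bigD1 (idxl k)) // (bigD1 (idxr k)) //.
  by rewrite eq_sym.
rewrite !pair !permM tpermL tpermR.
under eq_bigr => i /andP[il ir] do rewrite permM tpermD 1?eq_sym //.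
lia.
Qed.

Definition weight_bound := (n * (n * n))%N.
Definition coweight w := (weight_bound - weight w)%N.

Lemma weight_le w : (weight w <= weight_bound)%N.
Proof.
rewrite /weight_bound -{1}(card_ord n) -sum_nat_const; apply: leq_sum => i _.
by apply: leq_mul; exact: ltnW (ltn_ord _).
Qed.

Lemma coweight_descent k w :
  descent w k -> (coweight (simple k * w) < coweight w)%N.
Proof.
rewrite /descent /coweight => h; have := weight_simple k w.
have := weight_le w; have := weight_le (simple k * w)%g; lia.
Qed.

(** An increasing permutation satisfies [i <= w i] everywhere, and both sides
    have the same sum over [i]. *)
Lemma no_descent w : (forall k, ~~ descent w k) -> w = 1%g.
Proof.
move=> hw.
have ge m (hm : (m < n)%N) : (m <= w (Ordinal hm))%N.
  elim: m hm => [|m IH] hm //.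
  have hk : (m < n.-1)%N by rewrite ltn_predRL.
  have := hw (Ordinal hk); rewrite /descent -leqNgt.
  have -> : idxl (Ordinal hk) = Ordinal (ltnW hm) by apply: val_inj.
  have -> : idxr (Ordinal hk) = Ordinal hm by apply: val_inj.
  rewrite leq_eqVlt => /orP[/eqP/val_inj/perm_inj/(congr1 val)/= /n_Sn //|].
  exact: leq_ltn_trans (IH _).
have h : (\sum_(i < n) (i : nat) <= \sum_(i < n) w i ?= iff [forall i, val i == val (w i)])%N.
  by apply: leqif_sum => -[m hm] _; apply: leqif_eq; exact: ge.
have e : (\sum_(i < n) (i : nat) = \sum_(i < n) w i)%N.
  exact: (reindex_inj (@perm_inj _ w)).
move: h; rewrite /leqif e eqxx leqnn => -[_ /esym/forallP hi].
by apply/permP => i; rewrite perm1; apply/esym/val_inj/eqP.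
Qed.

Lemma simple_ind (P : 'S_n -> Prop) :
  P 1%g -> (forall k w, P w -> P (simple k * w)%g) -> forall w, P w.
Proof.
move=> P1 Ps w; have [m] := ubnP (coweight w); elim: m w => // m IH w hm.
have [/existsP[k dk]|/existsPn/no_descent-> //] := boolP [exists k, descent w k].
rewrite -(simpleK k w); apply/Ps/IH; have := coweight_descent dk; lia.
Qed.

End SimpleTranspositions.

Section CoxeterPresentation.
Variables (n : nat) (M : pzSemiRingType) (T : 'I_n.-1 -> M).
Hypothesis T2 : forall k, T k * T k = 1.
Hypothesis T_braid : forall k l : 'I_n.-1, l = k.+1 :> nat ->
  T k * T l * T k = T l * T k * T l.
Hypothesis T_comm : forall k l : 'I_n.-1, (k.+1 < l)%N || (l.+1 < k)%N ->
  T k * T l = T l * T k.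
Implicit Types (k l : 'I_n.-1) (w v : 'S_n).

(** The image of [w], obtained by removing descents, chosen arbitrarily, for as
    long as there are any; [m] bounds the number of steps. *)
Fixpoint cox_rec (m : nat) w : M :=
  if m is m'.+1 then
    if [pick k | descent w k] is Some k then cox_rec m' (simple k * w)%g * T k else 1
  else 1.

Lemma cox_rec_fuel m m' w :
  (coweight w <= m)%N -> (coweight w <= m')%N -> cox_rec m w = cox_rec m' w.
Proof.
elim: m m' w => [|m IH] [|m'] w hm hm' //=; case: pickP => // k dk;
  have d := coweight_descent dk; try lia.
by congr (_ * _); apply: IH; lia.
Qed.

Definition cox w : M := cox_rec (weight_bound n) w.

Lemma coxE w :
  cox w = if [pick k | descent w k] is Some k then cox (simple k * w)%g * T k else 1.
Proof.
have le v : (coweight v <= weight_bound n)%N by exact: leq_subr.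
(* One unit of extra fuel exposes the recursion step. *)
rewrite {1}/cox (cox_rec_fuel (le w) (leqW (le w))) /=.
by case: pickP.
Qed.

Lemma cox1 : cox 1%g = 1.
Proof.
rewrite coxE; case: pickP => // k; rewrite /descent !perm1 /=; lia.
Qed.

(** Independence of the choice of the descent: a diamond argument, by induction
    on [coweight w].  If [k] and [l] are descents of [w] with [|k - l| > 1], then
    both remain descents after the other one is removed, and the two orders of
    removal agree as [T k] and [T l] commute.  If [l = k + 1], then [w] is
    decreasing on three consecutive positions, and the two ways of sorting them
    completely are the two sides of the braid relation. *)
Lemma cox_descent w k : descent w k -> cox w = cox (simple k * w)%g * T k.
Proof.
have [m] := ubnP (coweight w); elim: m w k => // m IH w k hm dk.
have IHs l j : descent w l -> descent (simple l * w)%g j ->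
    cox (simple l * w)%g = cox (simple j * (simple l * w))%g * T j.
  by move=> dl dj; apply: IH dj; have := coweight_descent dl; lia.
have IHss l j i : descent w l -> descent (simple l * w)%g j ->
    descent (simple j * (simple l * w))%g i ->
    cox (simple l * w)%g * T l
      = cox (simple i * simple j * simple l * w)%g * (T i * T j * T l).
  move=> dl dj di; rewrite (IHs _ _ dl dj) (IH _ _ _ di); last first.
    by have := coweight_descent dj; have := coweight_descent dl; lia.
  by rewrite !mulgA !mulrA.
have adj (i j : 'I_n.-1) : j = i.+1 :> nat -> descent w i -> descent w j ->
    cox (simple i * w)%g * T i = cox (simple j * w)%g * T j.
  move=> ij di dj; have eij : idxl j = idxr i by apply: val_inj.
  have sip : simple i (idxl i) = idxr i := tpermL _ _.
  have siq : simple i (idxr i) = idxl i := tpermR _ _.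
  have sjq : simple j (idxr i) = idxr j by rewrite -eij; exact: tpermL.
  have sjr : simple j (idxr j) = idxr i by rewrite -eij; exact: tpermR.
  have sir : simple i (idxr j) = idxr j by rewrite tpermD // -val_eqE /=; lia.
  have sjp : simple j (idxl i) = idxl i by rewrite tpermD // -val_eqE /=; lia.
  move: (di) (dj); rewrite /descent eij => wqp wrq.
  have dij : descent (simple i * w)%g j.
    by rewrite /descent !permM eij siq sir; exact: ltn_trans wqp.
  have dji : descent (simple j * w)%g i.
    by rewrite /descent !permM sjq sjp; exact: ltn_trans wqp.
  have diji : descent (simple j * (simple i * w))%g i.
    by rewrite /descent !permM sjq sjp sir sip.
  have djij : descent (simple i * (simple j * w))%g j.
    by rewrite /descent !permM eij siq sir sjp sjr.
  rewrite (IHss i j i) // (IHss j i j) //.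
  by rewrite (simple_braid ij) (T_braid ij).
have far l : (k.+1 < l)%N || (l.+1 < k)%N -> descent w l ->
    cox (simple k * w)%g * T k = cox (simple l * w)%g * T l.
  move=> kl dl.
  have dkl : descent (simple k * w)%g l.
    by rewrite /descent !permM !tpermD // -val_eqE /=; lia.
  have dlk : descent (simple l * w)%g k.
    by rewrite /descent !permM !tpermD // -val_eqE /=; lia.
  rewrite (IHs k l) // (IHs l k) // !mulgA -!mulrA.
  by rewrite (T_comm kl) (simple_comm kl).
rewrite coxE; case: pickP => [l dl|/(_ k)]; last by rewrite dk.
have [e|e] := eqVneq (k : nat) l; first by rewrite (val_inj e).
have [kl|] := boolP ((k.+1 < l) || (l.+1 < k))%N; first exact/esym/far.
rewrite negb_or -!leqNgt => /andP[kl lk].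
have [e'|e'] : l = k.+1 :> nat \/ k = l.+1 :> nat by lia.
- exact/esym/adj.
- exact: adj.
Qed.

Lemma cox_simpleM w k : cox (simple k * w)%g = cox w * T k.
Proof.
have [dk|ndk] := boolP (descent w k); first by rewrite (cox_descent dk) -mulrA T2 mulr1.
rewrite (@cox_descent _ k) ?simpleK //.
move: ndk; rewrite /descent !permM tpermL tpermR -leqNgt leq_eqVlt.
by case/orP => // /eqP/val_inj/perm_inj/eqP; rewrite (negPf (idxlr_neq k)).
Qed.

Lemma coxM w v : cox (w * v)%g = cox v * cox w.
Proof.
elim/simple_ind: w => [|k w IH]; first by rewrite mul1g cox1 mulr1.
by rewrite -mulgA !cox_simpleM IH mulrA.
Qed.

Lemma cox_simple k : cox (simple k) = T k.
Proof. by rewrite -[simple k]mulg1 cox_simpleM cox1 mul1r. Qed.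

End CoxeterPresentation.

(** * Brackets *)

(** The shape of the recursion for brackets and for transpositions: the upper
    index grows by conjugation with a simple transposition. *)
Lemma ltn_ord_ind (n : nat) (P : 'I_n -> 'I_n -> Prop) :
  (forall k : 'I_n.-1, P (idxl k) (idxr k)) ->
  (forall (i : 'I_n) (k : 'I_n.-1), (i < k)%N -> P i (idxl k) -> P i (idxr k)) ->
  forall i j : 'I_n, (i < j)%N -> P i j.
Proof.
move=> Pb Ps i [j hj]; elim: j hj => [|j IH] hj //= ij.
have hk : (j < n.-1)%N by rewrite ltn_predRL.
have -> : Ordinal hj = idxr (Ordinal hk) by apply: val_inj.
have [e|ne] := eqVneq (i : nat) j.
  have -> : i = idxl (Ordinal hk) by apply: val_inj.
  exact: Pb.
have {ne}ij : (i < j)%N by rewrite ltn_neqAle ne.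
apply: Ps => //; have -> : idxl (Ordinal hk) = Ordinal (ltnW hj) by apply: val_inj.
exact: IH.
Qed.

Section Between.
Variable m : nat.

Definition between (a b : nat) : seq 'I_m := [seq l : 'I_m <- enum 'I_m | (a <= l < b)%N].

Lemma val_between a b : (b <= m)%N -> map val (between a b) = iota a (b - a).
Proof.
move=> bm; rewrite -(filter_map _ (fun l => (a <= l < b)%N)) val_enum_ord.
apply: (irr_sorted_eq ltn_trans ltnn).
- by apply: sorted_filter; [exact: ltn_trans|exact: iota_ltn_sorted].
- exact: iota_ltn_sorted.
- by move=> l; rewrite mem_filter !mem_iota; lia.
Qed.

Lemma between_rcons a (k : 'I_m) : (a <= k)%N ->
  between a k.+1 = rcons (between a k) k.
Proof.
move=> ak; apply: (inj_map val_inj); rewrite map_rcons !val_between // 1?ltnW //.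
by rewrite subSn // -addn1 iotaD /= subnKC // cats1.
Qed.

Lemma between_nil a (b : nat) : (b <= a)%N -> between a b = [::].
Proof.
by move=> ba; apply/eqP; rewrite -[_ == _]negbK -has_filter; apply/hasPn => l _; lia.
Qed.

End Between.

Section Brackets.
Variables (n : nat) (A : pzRingType) (T : 'I_n.-1 -> A).

Definition bracket_word (i j : nat) : A :=
  (\prod_(k <- rev (enum 'I_n.-1) | (i < k < j)%N) T k) *
  (\prod_(k <- enum 'I_n.-1 | (i <= k < j)%N) T k).

(** The element [[i, j]] formed from arbitrary elements [T k] of a ring. *)
Definition bracket (i j : nat) : A :=
  if (i < j)%N then (-1) ^+ (j - i - 1) * bracket_word i j
  else - ((-1) ^+ (i - j - 1) * bracket_word j i).

Lemma bracket_wordE i j : bracket_word i j =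
  (\prod_(k <- rev (between n.-1 i.+1 j)) T k) * \prod_(k <- between n.-1 i j) T k.
Proof. by rewrite /between -filter_rev !big_filter. Qed.

Lemma bracket_simple (k : 'I_n.-1) : bracket k k.+1 = T k.
Proof.
rewrite /bracket ltnSn subSnn expr0 mul1r bracket_wordE.
rewrite (between_nil _ (leqnn k.+1)) between_rcons // (between_nil _ (leqnn k)).
by rewrite /= big_nil big_seq1 mul1r.
Qed.

Lemma bracketS i (k : 'I_n.-1) : (i < k)%N ->
  bracket i k.+1 = - (T k * bracket i k * T k).
Proof.
move=> ik; have ik1 := ltnW ik; rewrite /bracket ik (ltn_trans ik (ltnSn k)).
rewrite !bracket_wordE !between_rcons //.
rewrite rev_rcons big_cons big_rcons /=.
have -> : (k.+1 - i - 1 = (k - i - 1).+1)%N by lia.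
rewrite exprS mulN1r mulNr; congr (- _).
have cT d : T k * (-1) ^+ d = (-1) ^+ d * T k.
  by exact/commr_sign.
by rewrite !mulrA cT.
Qed.

Lemma bracketC i j : i != j -> bracket j i = - bracket i j.
Proof. by rewrite /bracket; case: ltngtP; rewrite ?opprK. Qed.
End Brackets.

(** * Twisting by differences of Clifford generators *)

Section CliffordTwist.
Variables (K : fieldType) (n : nat) (D : superAlgebra K) (rt : K).
Hypothesis two_neq0 : 2%:R != 0 :> K.
Hypothesis rt2 : rt ^+ 2 = - 2%:R.

Lemma rt_neq0 : rt != 0.
Proof.
apply: contra_neq two_neq0 => e; apply/eqP.
by rewrite -oppr_eq0 -rt2 e expr0n.
Qed.

Lemma rtVV_two : rt^-1 * rt^-1 * 2%:R = -1.
Proof.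
by rewrite -[2%:R]opprK -rt2 mulrN -expr2 -exprMn mulVf ?expr1n // rt_neq0.
Qed.

Lemma scale_half (z : D) : (rt^-1 * rt^-1) *: - (2%:R * z) = z.
Proof. by rewrite mulr_natl -scaler_nat scalerN scalerA rtVV_two scaleN1r opprK. Qed.

Lemma scale_rtV_inj (z z' : D) : rt^-1 *: z = rt^-1 *: z' -> z = z'.
Proof. exact: (scalerI (invr_neq0 rt_neq0)). Qed.

Variable C : 'I_n -> D.
Hypothesis C_sqr : forall i, C i * C i = 1.
Hypothesis C_anti : forall i j, i != j -> C i * C j = - (C j * C i).

Lemma C_inj i (z z' : D) : C i * z = C i * z' -> z = z'.
Proof. by move=> e; rewrite -[z]mul1r -[z']mul1r -(C_sqr i) -!mulrA e. Qed.

Definition cdiff i j : D := C i - C j.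

Lemma cdiff_sqr i j : i != j -> cdiff i j * cdiff i j = 2%:R.
Proof.
move=> ij; rewrite /cdiff mulrBl !mulrBr !C_sqr (C_anti ij) opprK opprB.
by rewrite addrACA subrr addr0.
Qed.

Lemma cdiff_inj i j (z z' : D) : i != j ->
  cdiff i j * z = cdiff i j * z' -> z = z'.
Proof.
move=> ij e; have : 2%:R * z = 2%:R * z' by rewrite -(cdiff_sqr ij) -!mulrA e.
by rewrite !mulr_natl -!scaler_nat => /(scalerI two_neq0).
Qed.

Lemma cdiff_anti i j k l : i != k -> i != l -> j != k -> j != l ->
  cdiff i j * cdiff k l = - (cdiff k l * cdiff i j).
Proof.
move=> ik il jk jl; rewrite /cdiff !mulrBl !mulrBr.
rewrite (C_anti ik) (C_anti il) (C_anti jk) (C_anti jl) !opprB !opprK.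
by rewrite (addrC (- (C k * C i))) addrACA (addrC (- (C k * C i))).
Qed.

(** The three squares give [a * b + b * a = - 2%:R], and this brings both
    products into the same form. *)
Lemma braid_of_squares (a b : D) :
  a * a = 2%:R -> b * b = 2%:R -> (a + b) * (a + b) = 2%:R ->
  (a * b * a = - (2%:R * (a + b))) * (b * a * b = - (2%:R * (a + b))).
Proof.
move=> aa bb; rewrite mulrDl !mulrDr aa bb addrA -[RHS]add0r => /addIr.
rewrite -addrA => /addr0_eq h.
have e : a * b = - 2%:R - b * a by rewrite h addrK.
have e' : b * a = - 2%:R - a * b by rewrite e opprB addrC subrK.
have c (z : D) : z * 2%:R = 2%:R * z by rewrite mulr_natl mulr_natr.
split; first by rewrite e mulrBl mulNr -mulrA aa c opprD.
by rewrite e' mulrBl mulNr -mulrA bb c opprD addrC.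
Qed.

Lemma cdiff_braid i j k : i != j -> j != k -> i != k ->
  (cdiff i j * cdiff j k * cdiff i j = - (2%:R * cdiff i k)) *
  (cdiff j k * cdiff i j * cdiff j k = - (2%:R * cdiff i k)).
Proof.
move=> ij jk ik; have e : cdiff i k = cdiff i j + cdiff j k.
  by rewrite /cdiff addrA subrK.
by rewrite e; apply: braid_of_squares; rewrite -?e cdiff_sqr.
Qed.

Section Twist.
Variables (T S : 'I_n.-1 -> D).
Hypothesis T_C : forall k i, T k * C i = - (C i * T k).
Hypothesis S_T : forall k, S k = rt^-1 *: (cdiff (idxl k) (idxr k) * T k).

Local Notation a k := (cdiff (idxl k) (idxr k)).

Lemma T_cdiff k i j : T k * cdiff i j = - (cdiff i j * T k).
Proof. by rewrite mulrBl mulrBr !T_C opprB opprK addrC. Qed.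

Lemma TM_cdiff k i j (x z : D) :
  x * T k * (cdiff i j * z) = - (x * cdiff i j * (T k * z)).
Proof. by rewrite mulrA -(mulrA x) T_cdiff mulrN !mulNr !mulrA. Qed.

Lemma twist_mul k l :
  S k * S l = (rt^-1 * rt^-1) *: - (a k * a l * (T k * T l)).
Proof. by rewrite !S_T -superAl -superAr scalerA TM_cdiff. Qed.

Lemma twist_sqr k : S k * S k = T k * T k.
Proof. by rewrite twist_mul cdiff_sqr ?idxlr_neq // scale_half. Qed.

Lemma twist_mul3 k l m : S k * S l * S m =
  (rt^-1 * rt^-1 * rt^-1) *: - (a k * a l * a m * (T k * T l * T m)).
Proof.
rewrite twist_mul (S_T m) -superAl -superAr scalerA; congr (_ *: _).
rewrite mulNr; congr (- _); rewrite !mulrA -[_ * T l * a m]mulrA T_cdiff.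
by rewrite mulrN !mulNr mulrA -[_ * T k * a m]mulrA T_cdiff mulrN !mulNr opprK !mulrA.
Qed.

(** Collecting the Clifford factors on the left gives [a_k a_l a_k] and
    [a_l a_k a_l], which are equal by [cdiff_braid] and can be cancelled. *)
Lemma twist_braid (k l : 'I_n.-1) : l = k.+1 :> nat ->
  S k * S l * S k = S l * S k * S l <-> T k * T l * T k = T l * T k * T l.
Proof.
move=> lk; have e : idxl l = idxr k by apply: val_inj.
have kr : idxl k != idxr l by rewrite -val_eqE /= lk; lia.
have lr : idxr k != idxr l by rewrite -e idxlr_neq.
have [ekl elk] := cdiff_braid (idxlr_neq k) lr kr.
have ne : rt^-1 * rt^-1 * rt^-1 != 0 by rewrite !mulf_neq0 // invr_neq0 // rt_neq0.
rewrite !twist_mul3 e ekl elk; move: (rt^-1 * rt^-1 * rt^-1) ne => c ne.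
split=> [|-> //].
rewrite !mulNr !opprK -!mulrA !mulr_natl -!scaler_nat => /(scalerI ne) /(scalerI two_neq0).
by move/(cdiff_inj kr); rewrite !mulrA.
Qed.

(** The Clifford factors [a_k] and [a_l] of [S k] and [S l] anticommute, which
    accounts for the sign between the two relations. *)
Lemma twist_comm (k l : 'I_n.-1) : (k.+1 < l)%N || (l.+1 < k)%N ->
  S k * S l = S l * S k <-> T k * T l = - (T l * T k).
Proof.
move=> kl; have ne : rt^-1 * rt^-1 != 0 by rewrite !mulf_neq0 // invr_neq0 // rt_neq0.
rewrite !twist_mul cdiff_anti -?val_eqE /=; try lia.
move: (rt^-1 * rt^-1) ne => c ne.
rewrite mulNr opprK; split=> [/(scalerI ne)|->].
  rewrite -mulrN -!mulrA => /(cdiff_inj (idxlr_neq l))/(cdiff_inj (idxlr_neq k)).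
  by move=> ->.
by rewrite mulrN.
Qed.

(** Conjugation by [a_k] acts on the Clifford generators as minus the simple
    transposition; combined with the sign of [T_C] this gives [twist_C]. *)
Lemma cdiff_C k i : a k * C (simple k i) = - (C i * a k).
Proof.
rewrite /simple /cdiff mulrBl mulrBr; case: tpermP => [->|->|/eqP il /eqP ir].
- by rewrite !C_sqr opprB.
- by rewrite !C_sqr opprB.
- by rewrite (C_anti il) (C_anti ir) opprB !opprK addrC.
Qed.

Lemma twist_C k i : S k * C i = C (simple k i) * S k.
Proof.
rewrite S_T -superAl -superAr -mulrA T_C mulrN !mulrA; congr (_ *: _).
by have := cdiff_C k (simple k i); rewrite tpermK => ->; rewrite mulNr opprK.
Qed.

Lemma twist_odd k (z z' : D) : (forall i, z' * C i = - (C i * z')) ->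
  S k * z = z' * S k <-> T k * z = - (z' * T k).
Proof.
move=> zC; have za : z' * a k = - (a k * z').
  by rewrite mulrBl mulrBr !zC opprB opprK addrC.
rewrite S_T -superAl -superAr mulrA za mulNr -!mulrA -mulrN.
by split=> [/scale_rtV_inj/(cdiff_inj (idxlr_neq k))|->].
Qed.

Lemma twist_even k (z z' : D) : (forall i, z' * C i = C i * z') ->
  S k * z = z' * S k <-> T k * z = z' * T k.
Proof.
move=> zC; have za : z' * a k = a k * z' by rewrite mulrBl mulrBr !zC.
rewrite S_T -superAl -superAr mulrA za -!mulrA.
by split=> [/scale_rtV_inj/(cdiff_inj (idxlr_neq k))|->].
Qed.

Lemma bracket_C (i j l : 'I_n) : (i < j)%N ->
  bracket T i j * C l = - (C l * bracket T i j).
Proof.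
move: i j; apply: (@ltn_ord_ind n
  (fun i j => bracket T i j * C l = - (C l * bracket T i j)))
  => [k|i k ik IH]; rewrite /= ?bracket_simple ?bracketS //.
have h : T k * bracket T i k * C l = C l * (T k * bracket T i k).
  by rewrite [RHS]mulrA -[C l * T k]opprK -T_C -mulrA IH mulrN mulNr mulrA.
by rewrite mulNr mulrN -[in LHS]mulrA T_C mulrN [_ * (C l * _) in LHS]mulrA h !mulrA.
Qed.

Lemma bracket_cdiff (i j k l : 'I_n) : (i < j)%N ->
  bracket T i j * cdiff k l = - (cdiff k l * bracket T i j).
Proof. by move=> ij; rewrite mulrBl mulrBr !bracket_C // opprB opprK addrC. Qed.

End Twist.

Section Symmetric.
Variables (T : 'I_n.-1 -> D) (S : 'S_n -> D).
Hypothesis T_C : forall k i, T k * C i = - (C i * T k).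
Hypothesis S_T : forall k, S (simple k) = rt^-1 *: (cdiff (idxl k) (idxr k) * T k).
Hypothesis S_mulg : forall v w, S v * S w = S (w * v)%g.

Let S_cdiff k i j :
  S (simple k) * cdiff i j = cdiff (simple k i) (simple k j) * S (simple k).
Proof. by rewrite mulrBl mulrBr !(twist_C T_C (S := fun k => S (simple k)) S_T). Qed.

(** The sign in the definition of [[i, j]] is made for this: conjugation by
    [S (simple k)] is minus conjugation by [T k] on elements that anticommute with
    the [C i], and one such sign appears in [bracketS]. *)
Lemma twist_tperm (i j : 'I_n) : i != j ->
  S (tperm i j) = rt^-1 *: (cdiff i j * bracket T i j).
Proof.
move=> ne; wlog: i j ne / (i < j)%N => [hw|].
  have [ij|ji] := boolP (i < j)%N; first exact: hw.
  have ne' : j != i by rewrite eq_sym.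
  rewrite tpermC (hw j i ne'); last by rewrite ltn_neqAle ne' leqNgt.
  rewrite bracketC //.
  by rewrite mulrN -mulNr /cdiff opprB.
move=> {ne}; move: i j; apply: (@ltn_ord_ind n (fun i j =>
  S (tperm i j) = rt^-1 *: (cdiff i j * bracket T i j))) => [k|i k ik IH] /=.
  by rewrite bracket_simple; exact: S_T.
have il : i != idxl k by rewrite -val_eqE /= neq_ltn ik.
have ir : i != idxr k by rewrite -val_eqE /= neq_ltn ltnS (ltnW ik).
have -> : tperm i (idxr k) = (simple k * tperm i (idxl k) * simple k)%g.
  have sV : (simple k)^-1%g = simple k := tpermV _ _.
  by rewrite -{1}sV -mulgA -conjgE tpermJ /simple tpermL tpermD // eq_sym.
rewrite -!S_mulg IH bracketS // -superAl -superAr; congr (_ *: _).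
rewrite -[_ * _ * S _]mulrA mulrA S_cdiff /simple tpermL tpermD 1?eq_sym // -mulrA.
congr (_ * _); rewrite -/(simple k) S_T -!superAl -!superAr scalerA.
rewrite [bracket _ _ _ * _]mulrA bracket_cdiff // mulNr mulrN.
rewrite -[cdiff _ _ * _ * T k]mulrA (TM_cdiff T_C).
rewrite cdiff_sqr ?idxlr_neq //; apply: oppr_inj; rewrite opprK -scalerN opprK.
by rewrite scale_half // mulrA.
Qed.

(** The factor [1 + C j * C i] turns [C i - C j] into [2 * C i], so that the
    right-hand sides of the two commutator relations correspond. *)
Lemma twist_tperm_term (i j : 'I_n) : i != j ->
  (1 + C j * C i) * S (tperm i j) = rt *: (C i * bracket T j i).
Proof.
move=> ij; have e : (1 + C j * C i) * cdiff i j = 2%:R * C i.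
  rewrite /cdiff mulrDl mul1r mulrBr -mulrA C_sqr mulr1 -mulrA (C_anti ij) mulrN mulrA.
  by rewrite C_sqr mul1r opprK addrA subrK mulr_natl mulr2n.
have ji : j != i by rewrite eq_sym.
rewrite twist_tperm // (@bracketC _ _ T j i ji) -superAr mulrA e mulr_natl.
rewrite -scaler_nat -superAl.
rewrite scalerA mulrN scalerN -scaleNr; congr (_ *: _).
by rewrite -mulrN -rt2 expr2 mulKf ?rt_neq0.
Qed.

Variables (Xi X Y : 'I_n -> D).
Hypothesis Xi_C : forall i j, Xi i * C j = - (C j * Xi i).
Hypothesis Y_C : forall i j, Y i * C j = C j * Y i.
Hypothesis X_Xi : forall i, X i = rt *: (C i * Xi i).

Lemma rt_scale_inj (z z' : D) : rt *: z = rt *: z' -> z = z'.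
Proof. exact: (scalerI rt_neq0). Qed.

Lemma X_comm i j : i != j ->
  X i * X j = X j * X i <-> Xi i * Xi j = - (Xi j * Xi i).
Proof.
have e k l : X k * X l = (rt * rt) *: - (C k * C l * (Xi k * Xi l)).
  rewrite !X_Xi -superAl -superAr scalerA mulrA -[_ * _ * C l]mulrA Xi_C.
  by rewrite mulrN mulNr !mulrA.
move=> ij; rewrite !e (C_anti ij) mulNr opprK -scalerA -[in RHS]scalerA.
split=> [|->]; last by rewrite mulrN.
by move/rt_scale_inj/rt_scale_inj; rewrite -mulrN -!mulrA => /C_inj/C_inj.
Qed.

Lemma C_X i : C i * X i = - (X i * C i).
Proof.
by rewrite X_Xi -superAl -superAr -mulrA Xi_C mulrN scalerN opprK.
Qed.

Lemma C_X_neq i j : i != j -> C j * X i = X i * C j.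
Proof.
move=> ij; rewrite X_Xi -superAl -superAr -mulrA Xi_C mulrN !mulrA.
by rewrite (C_anti ij) mulNr opprK.
Qed.

Lemma Y_X_commutator i j :
  Y j * X i - X i * Y j = rt *: (C i * (Y j * Xi i - Xi i * Y j)).
Proof.
by rewrite X_Xi -superAl -superAr -scalerBr mulrA Y_C mulrBr !mulrA.
Qed.

(** As [Y] commutes with the [C i], the factor [rt * C i] comes out of the
    commutator and can be cancelled against the one in [twist_tperm_term]. *)
Lemma Y_X_neq u (i j : 'I_n) : i != j ->
  Y j * X i - X i * Y j = u *: ((1 + C j * C i) * S (tperm i j)) <->
  Y j * Xi i - Xi i * Y j = u *: bracket T j i.
Proof.
move=> ij; rewrite Y_X_commutator twist_tperm_term // scalerA mulrC -scalerA superAr.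
by split=> [/rt_scale_inj/C_inj|->].
Qed.

Lemma Y_X_diag u (i : 'I_n) :
  Y i * X i - X i * Y i
    = - (u *: \sum_(k | k != i) (1 + C k * C i) * S (tperm k i)) <->
  Y i * Xi i - Xi i * Y i = u *: \sum_(k | k != i) bracket T i k.
Proof.
have -> : - (u *: \sum_(k | k != i) (1 + C k * C i) * S (tperm k i))
    = rt *: (C i * (u *: \sum_(k | k != i) bracket T i k)).
  rewrite -superAr scalerA [rt * u]mulrC -scalerA -scalerN; congr (_ *: _).
  rewrite mulr_sumr scaler_sumr -sumrN; apply: eq_bigr => k ki.
  have ik : i != k by rewrite eq_sym.
  rewrite tpermC twist_tperm_term // (@bracketC _ _ T i k ik).
  by rewrite mulrN scalerN opprK.
rewrite Y_X_commutator.
by split=> [/rt_scale_inj/C_inj|->].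
Qed.

End Symmetric.
End CliffordTwist.

(** * Representations and universal properties *)

Section Representations.
Variables (K : comNzRingType) (n : nat) (u : K) (D : superAlgebra K).

Record clifford_rep (C : 'I_n -> D) : Prop := CliffordRep {
  cr_sqr : forall i, C i * C i = 1;
  cr_anti : forall i j, i != j -> C i * C j = - (C j * C i);
  cr_odd : forall i, homog true (C i)
}.

(** Elements of [D] subject to the relations of the Hecke-Clifford algebra, with
    the parities of its generators. *)
Record dahca_rep (X Y C : 'I_n -> D) (S : 'S_n -> D) : Prop := DahcaRep {
  dr_C : clifford_rep C;
  dr_S1 : S 1%g = 1;
  dr_SM : forall v w, S v * S w = S (w * v)%g;
  dr_XX : forall i j, X i * X j = X j * X i;
  dr_YY : forall i j, Y i * Y j = Y j * Y i;
  dr_SX : forall w i, S w * X i = X (w i) * S w;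
  dr_SY : forall w i, S w * Y i = Y (w i) * S w;
  dr_SC : forall w i, S w * C i = C (w i) * S w;
  dr_CX : forall i, C i * X i = - (X i * C i);
  dr_CX_neq : forall i j, i != j -> C j * X i = X i * C j;
  dr_CY : forall i j, C j * Y i = Y i * C j;
  dr_YX_neq : forall i j, i != j ->
    Y j * X i - X i * Y j = u *: ((1 + C j * C i) * S (tperm i j));
  dr_YX : forall i, Y i * X i - X i * Y i
    = - (u *: \sum_(k | k != i) (1 + C k * C i) * S (tperm k i));
  dr_X_even : forall i, homog false (X i);
  dr_Y_even : forall i, homog false (Y i);
  dr_S_even : forall w, homog false (S w)
}.

(** Elements of [D] subject to the relations of the spin algebra.  The relations
    between [T] and [Xi] or [Y] are written uniformly in the index; in the
    presentation, the case of [idxr k] follows from that of [idxl k] by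
    [T k * T k = 1]. *)
Record spin_rep (Xi Y : 'I_n -> D) (T : 'I_n.-1 -> D) : Prop := SpinRep {
  sr_T2 : forall k, T k * T k = 1;
  sr_braid : forall k l : 'I_n.-1, l = k.+1 :> nat ->
    T k * T l * T k = T l * T k * T l;
  sr_TT : forall k l : 'I_n.-1, (k.+1 < l)%N || (l.+1 < k)%N ->
    T k * T l = - (T l * T k);
  sr_XiXi : forall i j, i != j -> Xi i * Xi j = - (Xi j * Xi i);
  sr_YY : forall i j, i != j -> Y i * Y j = Y j * Y i;
  sr_TXi : forall k i, T k * Xi i = - (Xi (simple k i) * T k);
  sr_TY : forall k i, T k * Y i = Y (simple k i) * T k;
  sr_YXi_neq : forall i j : 'I_n, i != j ->
    Y i * Xi j - Xi j * Y i = u *: bracket T i j;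
  sr_YXi : forall i : 'I_n,
    Y i * Xi i - Xi i * Y i = u *: \sum_(k | k != i) bracket T i k;
  sr_Xi_odd : forall i, homog true (Xi i);
  sr_Y_even : forall i, homog false (Y i);
  sr_T_odd : forall k, homog true (T k)
}.

Lemma clifford_lift (C : 'I_n -> D) : clifford_rep C ->
  exists2 f : clifford K n -> D, superalg_morph f & forall i, f (cl_c K i) = C i.
Proof.
move=> [sqr anti odd]; apply: presented_lift => // l r [i|i j ij].
- rewrite expr2; have [e1 eM] := @free_ev_morph K _ (fun=> true) D C.
  by rewrite eM e1 !free_ev_var.
- have [e1 eM] := @free_ev_morph K _ (fun=> true) D C.
  rewrite [RHS](linmapN (@free_ev_linear _ _ _ _ _)) [LHS]eM [in RHS]eM.
  by rewrite !free_ev_var; exact: anti.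
Qed.

Lemma dahca_lift (X Y C : 'I_n -> D) (S : 'S_n -> D) : dahca_rep X Y C S ->
  exists2 f : rational_DAHCa n u -> D, superalg_morph f &
    [/\ forall i, f (hc_x u i) = X i, forall i, f (hc_y u i) = Y i,
        forall i, f (hc_c u i) = C i & forall w, f (hc_s u w) = S w].
Proof.
move=> H; have Cr := dr_C H.
pose phi g := match g with HX i => X i | HY i => Y i | HC i => C i | HS w => S w end.
have [g|l r|f hf fE] := presented_lift (D := D) (phi := phi) (hc_rel_homog (u := u)).
- by case: g => i /=;
    [exact: (dr_X_even H i)|exact: (dr_Y_even H i)|exact: (cr_odd Cr i)|exact: (dr_S_even H i)].
- pose ev := @free_ev K _ (@hc_odd n) D phi; rewrite -/ev.
  have lev : linear ev := @free_ev_linear K _ (@hc_odd n) D phi.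
  have [ev1 evM] : monoid_morphism ev := @free_ev_morph K _ (@hc_odd n) D phi.
  (* Products of the abstract generators [v] are only accessible to [ev] through
     its morphism laws. *)
  have [v vE] : exists v, v = fvar K (@hc_odd n) by eexists.
  have evv g : ev (v g) = phi g by rewrite vE; exact: (@free_ev_var K _ (@hc_odd n) D phi g).
  clearbody ev.
  have evVV g g' : ev (v g * v g') = phi g * phi g' by rewrite evM !evv.
  have evN g g' : ev (- (v g * v g')) = - (phi g * phi g').
    by rewrite (linmapN lev) evVV.
  have evB g1 g2 g3 g4 :
      ev (v g1 * v g2 - v g3 * v g4) = phi g1 * phi g2 - phi g3 * phi g4.
    by rewrite (linmapD lev) evN evVV.
  have evS i j w : ev ((1 + v (HC j) * v (HC i)) * v (HS w)) = (1 + C j * C i) * S w.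
    by rewrite evM (linmapD lev) ev1 evM !evv.
  case=> [|w w'|i j|i j|w i|w i|w i|i|i|i j ij|i j ij|i|i j ij|i j ij|i];
    rewrite ?expr2 -vE.
  + by rewrite evv ev1; exact: (dr_S1 H).
  + by rewrite [LHS]evVV [RHS]evv; exact: (dr_SM H w w').
  + by rewrite [LHS]evVV [RHS]evVV; exact: (dr_XX H i j).
  + by rewrite [LHS]evVV [RHS]evVV; exact: (dr_YY H i j).
  + by rewrite [LHS]evVV [RHS]evVV; exact: (dr_SX H w i).
  + by rewrite [LHS]evVV [RHS]evVV; exact: (dr_SY H w i).
  + by rewrite [LHS]evVV [RHS]evVV; exact: (dr_SC H w i).
  + by rewrite [LHS]evVV [RHS]evN; exact: (dr_CX H i).
  + by rewrite [LHS]evVV [RHS]evVV; exact: (dr_CY H i i).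
  + by rewrite [LHS]evVV [RHS]evVV; exact: (dr_CX_neq H ij).
  + by rewrite [LHS]evVV [RHS]evVV; exact: (dr_CY H i j).
  + by rewrite [LHS]evVV [RHS]ev1; exact: (cr_sqr Cr i).
  + by rewrite [LHS]evVV [RHS]evN; exact: (cr_anti Cr ij).
  + by rewrite [LHS]evB [RHS](linmapZ lev) evS; exact: (dr_YX_neq H ij).
  + rewrite [LHS]evB [RHS](linmapN lev) (linmapZ lev) (linmap_sum lev) [LHS](dr_YX H).
    by congr (- (u *: _)); apply: eq_bigr => k _; rewrite evS.
exists f => //; split; move=> ?; exact: fE.
Qed.

Lemma morph_bracket (ev : free_superalg K (@sp_odd n) -> D) (T : 'I_n.-1 -> D) :
  linear ev -> monoid_morphism ev ->
  (forall k, ev (fvar K (@sp_odd n) (ST k)) = T k) ->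
  forall i j : 'I_n, ev (tbracket K i j) = bracket T i j.
Proof.
move=> lev [ev1 evM] evT i j.
have sign d : ev ((-1) ^+ d) = (-1) ^+ d.
  elim: d => [|d IH]; first by rewrite !expr0 ev1.
  by rewrite !exprS evM IH (linmapN lev) ev1.
have word i' j' : ev (tword K i' j') = bracket_word T i' j'.
  rewrite /tword /bracket_word evM !(big_morph _ evM ev1).
  by congr (_ * _); apply: eq_bigr => k _; exact: evT.
rewrite /tbracket /bracket; case: ifP => _; last rewrite (linmapN lev);
  by rewrite evM sign word.
Qed.

Lemma spin_lift (Xi Y : 'I_n -> D) (T : 'I_n.-1 -> D) : spin_rep Xi Y T ->
  exists2 f : rational_spin_DAHA n u -> D, superalg_morph f &
    [/\ forall i, f (sp_xi u i) = Xi i, forall i, f (sp_y u i) = Y i &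
        forall k, f (sp_t u k) = T k].
Proof.
move=> H.
pose phi g := match g with SXi i => Xi i | SY i => Y i | ST k => T k end.
have [g|l r|f hf fE] := presented_lift (D := D) (phi := phi) (sp_rel_homog (u := u)).
- by case: g => i /=; [exact: (sr_Xi_odd H i)|exact: (sr_Y_even H i)|exact: (sr_T_odd H i)].
- pose ev := @free_ev K _ (@sp_odd n) D phi; rewrite -/ev.
  have lev : linear ev := @free_ev_linear K _ (@sp_odd n) D phi.
  have [ev1 evM] : monoid_morphism ev := @free_ev_morph K _ (@sp_odd n) D phi.
  have [v vE] : exists v, v = fvar K (@sp_odd n) by eexists.
  have evv g : ev (v g) = phi g by rewrite vE; exact: (@free_ev_var K _ (@sp_odd n) D phi g).
  clearbody ev.
  have evVV g g' : ev (v g * v g') = phi g * phi g' by rewrite evM !evv.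
  have evVVV g1 g2 g3 : ev (v g1 * v g2 * v g3) = phi g1 * phi g2 * phi g3.
    by rewrite evM evVV evv.
  have evN g g' : ev (- (v g * v g')) = - (phi g * phi g').
    by rewrite (linmapN lev) evVV.
  have evB g1 g2 g3 g4 :
      ev (v g1 * v g2 - v g3 * v g4) = phi g1 * phi g2 - phi g3 * phi g4.
    by rewrite (linmapD lev) evN evVV.
  have evT (i j : 'I_n) : ev (tbracket K i j) = bracket T i j.
    by apply: morph_bracket => // k; rewrite -vE; exact: evv.
  have sl k : simple k (idxl k) = idxr k := tpermL _ _.
  case=> [k|k k' e|k k' e|i j ij|i j ij|k|k|k i il ir|k i il ir|i j ij|i];
    rewrite ?expr2 -vE.
  + by rewrite [LHS]evVV [RHS]ev1; exact: (sr_T2 H k).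
  + by rewrite [LHS]evVVV [RHS]evVVV; exact: (sr_braid H e).
  + by rewrite [LHS]evVV [RHS]evN; exact: (sr_TT H e).
  + by rewrite [LHS]evVV [RHS]evN; exact: (sr_XiXi H ij).
  + by rewrite [LHS]evVV [RHS]evVV; exact: (sr_YY H ij).
  + by rewrite [LHS]evVV [RHS]evN [LHS](sr_TXi H) sl.
  + by rewrite [LHS]evVV [RHS]evVV [LHS](sr_TY H) sl.
  + by rewrite [LHS]evVV [RHS]evN [LHS](sr_TXi H) /simple tpermD // eq_sym.
  + by rewrite [LHS]evVV [RHS]evVV [LHS](sr_TY H) /simple tpermD // eq_sym.
  + by rewrite [LHS]evB [RHS](linmapZ lev) evT; exact: (sr_YXi_neq H ij).
  + rewrite [LHS]evB [RHS](linmapZ lev) (linmap_sum lev) [LHS](sr_YXi H).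
    by congr (u *: _); apply: eq_bigr => k _; rewrite evT.
exists f => //; split; move=> ?; exact: fE.
Qed.

End Representations.

(** * The defining relations hold for the generators *)

Section Generators.
Variables (K : comNzRingType) (n : nat) (u : K).

Section QuotientProducts.
Variables (F Q : superAlgebra K) (pi : F -> Q).
Hypotheses (lpi : linear pi) (mpi : monoid_morphism pi).

Lemma pi_eq22 a b c d : pi (a * b) = pi (c * d) -> pi a * pi b = pi c * pi d.
Proof. by move: mpi => [_ piM]; rewrite !piM. Qed.

Lemma pi_eq33 a b c d e f : pi (a * b * c) = pi (d * e * f) ->
  pi a * pi b * pi c = pi d * pi e * pi f.
Proof. by move: mpi => [_ piM]; rewrite !piM. Qed.

Lemma pi_eq2N a b c d : pi (a * b) = pi (- (c * d)) -> pi a * pi b = - (pi c * pi d).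
Proof. by move: mpi => [_ piM]; rewrite (linmapN lpi) !piM. Qed.

Lemma pi_eqsq a : pi (a ^+ 2) = pi 1 -> pi a * pi a = 1.
Proof. by move: mpi => [pi1 piM]; rewrite expr2 piM pi1. Qed.

Lemma pi_eqB a b c d e : pi (a * b - c * d) = pi e ->
  pi a * pi b - pi c * pi d = pi e.
Proof. by move: mpi => [_ piM]; rewrite (linmapD lpi) (linmapN lpi) !piM. Qed.

Lemma pi_swap_term a b s : pi ((1 + a * b) * s) = (1 + pi a * pi b) * pi s.
Proof. by move: mpi => [pi1 piM]; rewrite piM (linmapD lpi) pi1 piM. Qed.

End QuotientProducts.

Lemma clifford_gens : clifford_rep (@cl_c K n).
Proof.
have R := quot_pi_rel (@clifford_rel_homog K n).
have [lpi mpi _] := quot_pi_morph (@clifford_rel_homog K n).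
split=> [i|i j ij|i].
- exact: (pi_eqsq mpi (R _ _ (cl_c2 K i))).
- exact: (pi_eq2N lpi mpi (R _ _ (cl_cc K ij))).
- exact: (homog_pgen (@clifford_rel_homog K n) i).
Qed.

Lemma dahca_gens : dahca_rep u (@hc_x K n u) (@hc_y K n u) (@hc_c K n u) (@hc_s K n u).
Proof.
have R := quot_pi_rel (@hc_rel_homog K n u).
have [lpi mpi _] := quot_pi_morph (@hc_rel_homog K n u).
have hg := homog_pgen (@hc_rel_homog K n u).
have E22 := pi_eq22 mpi; have E2N := pi_eq2N lpi mpi; have EB := pi_eqB lpi mpi.
split.
- split=> [i|i j ij|i].
  + exact: (pi_eqsq mpi (R _ _ (hc_c2 u i))).
  + exact: (E2N _ _ _ _ (R _ _ (hc_cc u ij))).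
  + exact: (hg (HC i)).
- exact: (etrans (R _ _ (hc_s1 n u)) mpi.1).
- by move=> v w; have := R _ _ (hc_ss u v w) => e; exact: (etrans (esym (mpi.2 _ _)) e).
- by move=> i j; exact: (E22 _ _ _ _ (R _ _ (hc_xx u i j))).
- by move=> i j; exact: (E22 _ _ _ _ (R _ _ (hc_yy u i j))).
- by move=> w i; exact: (E22 _ _ _ _ (R _ _ (hc_sx u w i))).
- by move=> w i; exact: (E22 _ _ _ _ (R _ _ (hc_sy u w i))).
- by move=> w i; exact: (E22 _ _ _ _ (R _ _ (hc_sc u w i))).
- by move=> i; exact: (E2N _ _ _ _ (R _ _ (hc_cx u i))).
- by move=> i j ij; exact: (E22 _ _ _ _ (R _ _ (hc_cx_ne u ij))).
- move=> i j; have [->|ij] := eqVneq i j.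
    exact: (E22 _ _ _ _ (R _ _ (hc_cy u j))).
  exact: (E22 _ _ _ _ (R _ _ (hc_cy_ne u ij))).
- move=> i j ij; apply: etrans (EB _ _ _ _ _ (R _ _ (hc_yx_ne u ij))) _.
  by apply: etrans (linmapZ lpi _ _) _; congr (u *: _); exact: pi_swap_term.
- move=> i; apply: etrans (EB _ _ _ _ _ (R _ _ (hc_yx u i))) _.
  apply: etrans (linmapN lpi _) _; congr (- _).
  apply: etrans (linmapZ lpi _ _) _; congr (u *: _).
  apply: etrans (linmap_sum lpi _ _ _) _; apply: eq_bigr => k _.
  exact: pi_swap_term.
- by move=> i; exact: (hg (HX i)).
- by move=> i; exact: (hg (HY i)).
- by move=> w; exact: (hg (HS w)).
Qed.

Lemma spin_gens : spin_rep u (@sp_xi K n u) (@sp_y K n u) (@sp_t K n u).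
Proof.
have R := quot_pi_rel (@sp_rel_homog K n u).
have [lpi mpi _] := quot_pi_morph (@sp_rel_homog K n u).
have hg := homog_pgen (@sp_rel_homog K n u).
have E22 := pi_eq22 mpi; have E2N := pi_eq2N lpi mpi; have EB := pi_eqB lpi mpi.
have T2 k : sp_t u k * sp_t u k = 1 := pi_eqsq mpi (R _ _ (sp_t2 u k)).
have piB (i j : 'I_n) :
    quot_pi (@sp_rel_homog K n u) (tbracket K i j) = bracket (@sp_t K n u) i j.
  exact: (morph_bracket lpi mpi).
split => //.
- by move=> k l kl; exact: (pi_eq33 mpi (R _ _ (sp_braid u kl))).
- by move=> k l kl; exact: (E2N _ _ _ _ (R _ _ (sp_tt u kl))).
- by move=> i j ij; exact: (E2N _ _ _ _ (R _ _ (sp_xixi u ij))).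
- by move=> i j ij; exact: (E22 _ _ _ _ (R _ _ (sp_yy u ij))).
- move=> k i; rewrite /simple; case: tpermP => [->|->|/eqP il /eqP ir].
  + exact: (E2N _ _ _ _ (R _ _ (sp_txi u k))).
  + have e : sp_t u k * sp_xi u (idxl k) = - (sp_xi u (idxr k) * sp_t u k).
      exact: (E2N _ _ _ _ (R _ _ (sp_txi u k))).
    have -> : sp_xi u (idxr k) = - (sp_t u k * sp_xi u (idxl k) * sp_t u k).
      by rewrite e mulNr opprK -mulrA T2 mulr1.
    by rewrite mulrN !mulrA T2 mul1r.
  + exact: (E2N _ _ _ _ (R _ _ (sp_txi_ne u il ir))).
- move=> k i; rewrite /simple; case: tpermP => [->|->|/eqP il /eqP ir].
  + exact: (E22 _ _ _ _ (R _ _ (sp_ty u k))).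
  + have e : sp_t u k * sp_y u (idxl k) = sp_y u (idxr k) * sp_t u k.
      exact: (E22 _ _ _ _ (R _ _ (sp_ty u k))).
    have -> : sp_y u (idxr k) = sp_t u k * sp_y u (idxl k) * sp_t u k.
      by rewrite e -mulrA T2 mulr1.
    by rewrite !mulrA T2 mul1r.
  + exact: (E22 _ _ _ _ (R _ _ (sp_ty_ne u il ir))).
- move=> i j ij; apply: etrans (EB _ _ _ _ _ (R _ _ (sp_yxi_ne u ij))) _.
  by apply: etrans (linmapZ lpi _ _) _; congr (u *: _).
- move=> i; apply: etrans (EB _ _ _ _ _ (R _ _ (sp_yxi u i))) _.
  apply: etrans (linmapZ lpi _ _) _; congr (u *: _).
  by apply: etrans (linmap_sum lpi _ _ _) _; apply: eq_bigr => k _.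
- by move=> i; exact: (hg (SXi i)).
- by move=> i; exact: (hg (SY i)).
- by move=> k; exact: (hg (ST k)).
Qed.

End Generators.

(** * The isomorphism *)

Section Correspondence.
Variables (K : fieldType) (n : nat) (D : superAlgebra K) (u rt : K).
Hypothesis two_neq0 : 2%:R != 0 :> K.
Hypothesis rt2 : rt ^+ 2 = - 2%:R.

Record supercommuting_rep (C Xi Y : 'I_n -> D) (T : 'I_n.-1 -> D) : Prop :=
  SupercommutingRep {
  sc_Xi : forall i j, Xi i * C j = - (C j * Xi i);
  sc_Y : forall i j, Y i * C j = C j * Y i;
  sc_T : forall k i, T k * C i = - (C i * T k)
}.

(** Relations with the simple transpositions imply those with all permutations,
    as the former generate. *)
Lemma simple_action (S : 'S_n -> D) (Z : 'I_n -> D) :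
  S 1%g = 1 -> (forall v w, S v * S w = S (w * v)%g) ->
  (forall k i, S (simple k) * Z i = Z (simple k i) * S (simple k)) ->
  forall w i, S w * Z i = Z (w i) * S w.
Proof.
move=> S1 SM SZ; elim/simple_ind => [|k w IH] i; first by rewrite S1 perm1 mul1r mulr1.
by rewrite -SM -mulrA SZ mulrA IH -mulrA permM.
Qed.

(** One half of the dictionary.  The Coxeter presentation extends
    [rt^-1 *: (a_k * T k)] from the simple transpositions to all permutations. *)
Lemma spin_to_dahca (C Xi Y : 'I_n -> D) (T : 'I_n.-1 -> D) :
  clifford_rep C -> spin_rep u Xi Y T -> supercommuting_rep C Xi Y T ->
  exists2 S : 'S_n -> D, dahca_rep u (fun i => rt *: (C i * Xi i)) Y C S &
    forall k, S (simple k) = rt^-1 *: ((C (idxl k) - C (idxr k)) * T k).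
Proof.
move=> [C2 CC Codd] Hs [XiC YC TC].
pose s k : D := rt^-1 *: (cdiff C (idxl k) (idxr k) * T k).
have s_T k : s k = rt^-1 *: (cdiff C (idxl k) (idxr k) * T k) by [].
have ss k : s k * s k = 1.
  by rewrite (twist_sqr two_neq0 rt2 C2 CC TC s_T) (sr_T2 Hs).
have sb (k l : 'I_n.-1) (kl : l = k.+1 :> nat) : s k * s l * s k = s l * s k * s l.
  exact/(twist_braid two_neq0 rt2 C2 CC TC s_T kl)/(sr_braid Hs).
have sc (k l : 'I_n.-1) (kl : (k.+1 < l)%N || (l.+1 < k)%N) : s k * s l = s l * s k.
  exact/(twist_comm two_neq0 rt2 C2 CC TC s_T kl)/(sr_TT Hs).
pose S := cox s.
have S1 : S 1%g = 1 := cox1 s.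
have SM v w : S v * S w = S (w * v)%g by rewrite /S (coxM ss sb sc).
have S_T k : S (simple k) = rt^-1 *: (cdiff C (idxl k) (idxr k) * T k).
  exact: (cox_simple ss sb sc).
have SC k i : S (simple k) * C i = C (simple k i) * S (simple k).
  exact: (twist_C C2 CC TC (S := fun k => S (simple k)) S_T).
have SXi k i : S (simple k) * Xi i = Xi (simple k i) * S (simple k).
  apply/(twist_odd two_neq0 rt2 C2 CC (S := fun k => S (simple k)) S_T) => //.
  exact: (sr_TXi Hs).
have SY k i : S (simple k) * Y i = Y (simple k i) * S (simple k).
  apply/(twist_even two_neq0 rt2 C2 CC (S := fun k => S (simple k)) S_T) => //.
  exact: (sr_TY Hs).
pose X i := rt *: (C i * Xi i).
have X_Xi i : X i = rt *: (C i * Xi i) by [].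
have [Xiodd Yev Todd] := And3 (sr_Xi_odd Hs) (sr_Y_even Hs) (sr_T_odd Hs).
exists S; last exact: S_T.
split => //.
- move=> i j; have [->//|ij] := eqVneq i j.
  exact/(X_comm two_neq0 rt2 C2 CC XiC X_Xi ij)/(sr_XiXi Hs).
- move=> i j; have [->//|ij] := eqVneq i j; exact: (sr_YY Hs ij).
- move=> w i; rewrite -superAr -superAl mulrA (simple_action S1 SM SC) -mulrA.
  by rewrite (simple_action S1 SM SXi) mulrA.
- exact: simple_action.
- exact: simple_action.
- exact: (C_X XiC X_Xi).
- exact: (C_X_neq CC XiC X_Xi).
- move=> i j ij; apply/(Y_X_neq two_neq0 rt2 C2 CC TC S_T SM YC X_Xi u ij).
  by rewrite (sr_YXi_neq Hs) // eq_sym.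
- move=> i; apply/(Y_X_diag two_neq0 rt2 C2 CC TC S_T SM YC X_Xi u i).
  exact: (sr_YXi Hs).
- by move=> i; apply: homogZ; exact: homogM (Codd i) (Xiodd i).
- elim/simple_ind => [|k w IH]; first by rewrite S1; exact: homog1.
  rewrite -SM; apply: homogM IH _; rewrite S_T; apply: homogZ.
  by apply: (homogM (b := true) (b' := true)) => //; exact: homogB.
Qed.

(** The other half.  Once [Xi] and [T] are known to supercommute with [C], the
    relations are read off from the same equivalences, in the other direction. *)
Lemma dahca_to_spin (X Y C : 'I_n -> D) (S : 'S_n -> D) :
  dahca_rep u X Y C S ->
  let Xi i := rt^-1 *: (C i * X i) in
  let T k := rt^-1 *: ((C (idxr k) - C (idxl k)) * S (simple k)) in
  spin_rep u Xi Y T /\ supercommuting_rep C Xi Y T.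
Proof.
move=> H Xi T; have [C2 CC Codd] := dr_C H; have rt0 := rt_neq0 two_neq0 rt2.
have T_S k : T k = - (rt^-1 *: (cdiff C (idxl k) (idxr k) * S (simple k))).
  by rewrite /T -scalerN -mulNr opprB.
have TC k i : T k * C i = - (C i * T k).
  rewrite T_S mulrN mulNr -superAl -superAr -mulrA (dr_SC H) mulrA.
  by rewrite (cdiff_C C2 CC) mulNr scalerN !opprK mulrA.
have S_T k : S (simple k) = rt^-1 *: (cdiff C (idxl k) (idxr k) * T k).
  rewrite T_S mulrN -superAr scalerN scalerA mulrA (cdiff_sqr C2 CC) ?idxlr_neq //.
  by rewrite -scalerN (scale_half two_neq0 rt2).
have XiC i j : Xi i * C j = - (C j * Xi i).
  rewrite /Xi -superAl -superAr -scalerN mulrA; congr (_ *: _).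
  have [<-|ij] := eqVneq i j.
    by rewrite -mulrA -[X i * C i]opprK -(dr_CX H) mulrN mulrA.
  by rewrite -mulrA -(dr_CX_neq H ij) !mulrA (CC i j ij) mulNr.
have YC i j : Y i * C j = C j * Y i by rewrite (dr_CY H).
have X_Xi i : X i = rt *: (C i * Xi i).
  by rewrite /Xi -superAr scalerA mulfV // scale1r mulrA C2 mul1r.
have SM := dr_SM H.
have SXi k i : S (simple k) * Xi i = Xi (simple k i) * S (simple k).
  by rewrite /Xi -superAr -superAl mulrA (dr_SC H) -mulrA (dr_SX H) mulrA.
have ss k : S (simple k) * S (simple k) = 1 by rewrite SM tperm2 (dr_S1 H).
split; last by split.
split => //.
- by move=> k; rewrite -(twist_sqr two_neq0 rt2 C2 CC TC (S := fun k => S (simple k)) S_T).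
- move=> k l kl; apply/(twist_braid two_neq0 rt2 C2 CC TC (S := fun k => S (simple k)) S_T kl).
  by rewrite /= !SM !mulgA (simple_braid kl).
- move=> k l kl; apply/(twist_comm two_neq0 rt2 C2 CC TC (S := fun k => S (simple k)) S_T kl).
  by rewrite /= !SM (simple_comm kl).
- move=> i j ij; apply/(X_comm two_neq0 rt2 C2 CC XiC X_Xi ij); exact: (dr_XX H).
- by move=> i j _; exact: (dr_YY H).
- by move=> k i; apply/(twist_odd two_neq0 rt2 C2 CC (S := fun k => S (simple k)) S_T).
- move=> k i; apply/(twist_even two_neq0 rt2 C2 CC (S := fun k => S (simple k)) S_T) => //.
  exact: (dr_SY H).
- move=> i j; rewrite eq_sym => ij.
  apply/(Y_X_neq two_neq0 rt2 C2 CC TC S_T SM YC X_Xi u ij).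
  exact: (dr_YX_neq H).
- move=> i; apply/(Y_X_diag two_neq0 rt2 C2 CC TC S_T SM YC X_Xi u i).
  exact: (dr_YX H).
- by move=> i; apply: homogZ; exact: homogM (Codd i) (dr_X_even H i).
- exact: (dr_Y_even H).
- move=> k; apply: homogZ.
  exact: homogM (homogB (Codd _) (Codd _)) (dr_S_even H _).
Qed.

End Correspondence.

Section RepresentationMorphisms.
Variables (K : comNzRingType) (n : nat) (u : K).

Lemma clifford_rep_morph (A B : superAlgebra K) (f : A -> B) (C : 'I_n -> A) :
  superalg_morph f -> clifford_rep C -> clifford_rep (f \o C).
Proof.
move=> [lf [f1 fM] fh] [C2 CC Codd]; split=> [i|i j ij|i] /=.
- by rewrite -fM C2 f1.
- by rewrite -!fM (CC _ _ ij) (linmapN lf).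
- exact: fh.
Qed.

Lemma bracket_morph (A B : superAlgebra K) (f : A -> B) (T : 'I_n.-1 -> A) i j :
  superalg_morph f -> f (bracket T i j) = bracket (f \o T) i j.
Proof.
move=> [lf [f1 fM] _].
have sign d : f ((-1) ^+ d) = (-1) ^+ d.
  by elim: d => [|d IH]; rewrite ?expr0 // !exprS fM IH (linmapN lf) f1.
by rewrite /bracket; case: ifP => _; rewrite ?(linmapN lf) fM sign
  /bracket_word fM !(big_morph f fM f1).
Qed.

Lemma spin_rep_morph (A B : superAlgebra K) (f : A -> B) (Xi Y : 'I_n -> A)
    (T : 'I_n.-1 -> A) :
  superalg_morph f -> spin_rep u Xi Y T -> spin_rep u (f \o Xi) (f \o Y) (f \o T).
Proof.
move=> hf [h1 h2 h3 h4 h5 h6 h7 h8 h9 h10 h11 h12].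
have [lf [f1 fM] fh] := hf; split=> /=.
- by move=> k; rewrite -fM h1 f1.
- by move=> k l kl; rewrite -!fM h2.
- by move=> k l kl; rewrite -!fM h3 // (linmapN lf).
- by move=> i j ij; rewrite -!fM h4 // (linmapN lf).
- by move=> i j ij; rewrite -!fM h5.
- by move=> k i; rewrite -!fM h6 (linmapN lf).
- by move=> k i; rewrite -!fM h7.
- move=> i j ij; rewrite -!fM -(linmapN lf) -(linmapD lf) h8 // (linmapZ lf).
  by rewrite (bracket_morph _ _ _ hf).
- move=> i; rewrite -!fM -(linmapN lf) -(linmapD lf) h9 (linmapZ lf) (linmap_sum lf).
  by congr (_ *: _); apply: eq_bigr => k _; rewrite (bracket_morph _ _ _ hf).
- by move=> i; exact: fh.
- by move=> i; exact: fh.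
- by move=> i; exact: fh.
Qed.

End RepresentationMorphisms.

Section Isomorphism.
Variables (K : fieldType) (n : nat) (u rt : K).
Hypothesis two_neq0 : 2%:R != 0 :> K.
Hypothesis rt2 : rt ^+ 2 = - 2%:R.

Variables H Cl Sp : superAlgebra K.
Variables (hx hy hc : 'I_n -> H) (hs : 'S_n -> H) (c : 'I_n -> Cl)
  (xi y : 'I_n -> Sp) (t : 'I_n.-1 -> Sp).
Hypotheses (rep_H : dahca_rep u hx hy hc hs) (rep_Cl : clifford_rep c)
  (rep_Sp : spin_rep u xi y t).
Hypothesis lift_H : forall (D : superAlgebra K) (X Y C : 'I_n -> D) (S : 'S_n -> D),
  dahca_rep u X Y C S -> exists2 f : H -> D, superalg_morph f &
    [/\ forall i, f (hx i) = X i, forall i, f (hy i) = Y i,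
        forall i, f (hc i) = C i & forall w, f (hs w) = S w].
Hypothesis lift_Cl : forall (D : superAlgebra K) (C : 'I_n -> D),
  clifford_rep C -> exists2 f : Cl -> D, superalg_morph f & forall i, f (c i) = C i.
Hypothesis lift_Sp : forall (D : superAlgebra K) (Xi Y : 'I_n -> D) (T : 'I_n.-1 -> D),
  spin_rep u Xi Y T -> exists2 f : Sp -> D, superalg_morph f &
    [/\ forall i, f (xi i) = Xi i, forall i, f (y i) = Y i & forall k, f (t k) = T k].
Hypothesis eq_H : forall (D : superAlgebra K) (f f' : H -> D),
  superalg_morph f -> superalg_morph f' ->
  (forall i, f (hx i) = f' (hx i)) -> (forall i, f (hy i) = f' (hy i)) ->
  (forall i, f (hc i) = f' (hc i)) -> (forall w, f (hs w) = f' (hs w)) -> f =1 f'.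
Hypothesis eq_Cl : forall (D : superAlgebra K) (f f' : Cl -> D),
  superalg_morph f -> superalg_morph f' -> (forall i, f (c i) = f' (c i)) -> f =1 f'.
Hypothesis eq_Sp : forall (D : superAlgebra K) (f f' : Sp -> D),
  superalg_morph f -> superalg_morph f' ->
  (forall i, f (xi i) = f' (xi i)) -> (forall i, f (y i) = f' (y i)) ->
  (forall k, f (t k) = f' (t k)) -> f =1 f'.
Hypothesis super_Cl_Sp : forall (D : superAlgebra K) (f : Cl -> D) (g : Sp -> D),
  superalg_morph f -> superalg_morph g ->
  supercommuting_rep (f \o c) (g \o xi) (g \o y) (g \o t) -> supercommuting f g.

Local Notation CS := (tensor Cl Sp).
Local Notation tc i := (tens (c i) 1 : CS).
Local Notation txi i := (tens 1 (xi i) : CS).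
Local Notation ty i := (tens 1 (y i) : CS).
Local Notation tT k := (tens 1 (t k) : CS).

Lemma tens_supercommuting :
  supercommuting_rep (fun i => tc i) (fun i => txi i) (fun i => ty i) (fun k => tT k).
Proof.
have Codd := cr_odd rep_Cl; split=> i j.
- exact: tens_anticomm (Codd j) (sr_Xi_odd rep_Sp i).
- exact: tens_comm (Codd j) (sr_Y_even rep_Sp i).
- exact: tens_anticomm (Codd j) (sr_T_odd rep_Sp i).
Qed.

(** Only the universal properties of the three algebras enter: the maps are
    induced by the two halves of the dictionary, and the composites fix the
    generators.  On permutations this is checked on simple transpositions, where
    it comes down to [a_k ^+ 2 = 2]. *)
Lemma dahca_tensor_iso :
  exists (Phi : H -> CS) (Psi : CS -> H),
    [/\ superalg_morph Phi, cancel Phi Psi, cancel Psi Phi,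
        [/\ forall i, Phi (hy i) = ty i, forall i, Phi (hc i) = tc i,
            forall i, Phi (hx i) = rt *: tens (c i) (xi i) &
            forall k, Phi (hs (simple k))
              = rt^-1 *: tens (c (idxl k) - c (idxr k)) (t k)] &
        [/\ forall i, Psi (ty i) = hy i, forall i, Psi (tc i) = hc i,
            forall i, Psi (txi i) = rt^-1 *: (hc i * hx i) &
            forall k, Psi (tT k)
              = rt^-1 *: ((hc (idxr k) - hc (idxl k)) * hs (simple k))]].
Proof.
have rt0 := rt_neq0 two_neq0 rt2.
have hl := tens_left_morph Cl Sp; have hr := tens_right_morph Cl Sp.
have rep_tc := clifford_rep_morph hl rep_Cl.
have [S dS S_T] := spin_to_dahca two_neq0 rt2 rep_tc (spin_rep_morph hr rep_Sp)
  tens_supercommuting.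
have [Phi hPhi [Phi_x Phi_y Phi_c Phi_s]] := lift_H dS.
have [sH scH] := dahca_to_spin two_neq0 rt2 rep_H.
have [f hf f_c] := lift_Cl (dr_C rep_H).
have [g hg [g_xi g_y g_t]] := lift_Sp sH.
have fg : supercommuting f g.
  apply: super_Cl_Sp => //; case: scH => h1 h2 h3.
  by split=> i j /=; rewrite f_c ?g_xi ?g_y ?g_t.
have [Psi hPsi PsiE] := tensor_lift hf hg fg.
have [[lPhi [Phi1 PhiM] _] [lPsi [Psi1 PsiM] _]] := conj hPhi hPsi.
have [[lf [f1 fM] _] [lg [g1 gM] _]] := conj hf hg.
have Psi_c i : Psi (tc i) = hc i by rewrite PsiE g1 mulr1 f_c.
have Psi_y i : Psi (ty i) = hy i by rewrite PsiE f1 mul1r g_y.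
have Psi_xi i : Psi (txi i) = rt^-1 *: (hc i * hx i).
  by rewrite PsiE f1 mul1r g_xi.
have Psi_t k : Psi (tT k) = rt^-1 *: ((hc (idxr k) - hc (idxl k)) * hs (simple k)).
  by rewrite PsiE f1 mul1r g_t.
have PhiB z z' : Phi (z - z') = Phi z - Phi z' by rewrite (linmapD lPhi) (linmapN lPhi).
have PsiB z z' : Psi (z - z') = Psi z - Psi z' by rewrite (linmapD lPsi) (linmapN lPsi).
have id_morph (A : superAlgebra K) : superalg_morph (id : A -> A) by split=> //; split.
have [[C2 CC _] [C2' CC' _]] := conj (dr_C rep_H) rep_tc.
exists Phi, Psi; split => //.
- apply: (eq_H (superalg_morph_comp hPhi hPsi) (id_morph _)) => [i|i|i|w] /=.
  + rewrite Phi_x (linmapZ lPsi) PsiM Psi_c Psi_xi -superAr scalerA mulfV // scale1r.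
    by rewrite mulrA C2 mul1r.
  + by rewrite Phi_y Psi_y.
  + by rewrite Phi_c Psi_c.
  + elim/simple_ind: w => [|k w IH]; first by rewrite (dr_S1 rep_H) Phi1 Psi1.
    rewrite -(dr_SM rep_H) PhiM PsiM IH; congr (_ * _).
    rewrite Phi_s S_T (linmapZ lPsi) PsiM PsiB !Psi_c Psi_t -superAr scalerA mulrA.
    rewrite -[hc (idxr k) - _]opprB mulrN mulNr.
    by rewrite (cdiff_sqr C2 CC) ?idxlr_neq // (scale_half two_neq0 rt2).
- apply: (tensor_eq (superalg_morph_comp hPsi hPhi) (id_morph _)) => [a|b] /=.
  + apply: (eq_Cl (superalg_morph_comp hl (superalg_morph_comp hPsi hPhi)) hl) => i /=.
    by rewrite Psi_c Phi_c.
  + apply: (eq_Sp (superalg_morph_comp hr (superalg_morph_comp hPsi hPhi)) hr)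
      => [i|i|k] /=.
    * rewrite Psi_xi (linmapZ lPhi) PhiM Phi_c Phi_x -superAr scalerA mulVf // scale1r.
      by rewrite mulrA C2' mul1r.
    * by rewrite Psi_y Phi_y.
    * rewrite Psi_t (linmapZ lPhi) PhiM PhiB !Phi_c Phi_s S_T -superAr scalerA mulrA.
      rewrite -[tc (idxr k) - _]opprB !mulNr.
      by rewrite (cdiff_sqr C2' CC') ?idxlr_neq // (scale_half two_neq0 rt2).
- split=> // [i|k]; first by rewrite tens_split Phi_x.
  rewrite tens_split Phi_s S_T.
  by rewrite (linmapD (tens_linl _)) (linmapN (tens_linl _)).
Qed.

End Isomorphism.

Theorem theorem4p2 (R : realType) (n : nat) (u rt : R[i])
    (hn : (0 < n)%N) (hu : u != 0) (hrt : rt ^+ 2 = - 2%:R) :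
  exists (Phi : rational_DAHCa n u -> tensor (clifford R[i] n) (rational_spin_DAHA n u))
         (Psi : tensor (clifford R[i] n) (rational_spin_DAHA n u) -> rational_DAHCa n u),
    [/\ superalg_morph Phi, cancel Phi Psi, cancel Psi Phi,
        [/\ forall i : 'I_n, Phi (hc_y u i) = tens 1 (sp_y u i),
            forall i : 'I_n, Phi (hc_c u i) = tens (cl_c R[i] i) 1,
            forall i : 'I_n,
              Phi (hc_x u i) = rt *: tens (cl_c R[i] i) (sp_xi u i) &
            forall k : 'I_n.-1,
              Phi (hc_s u (tperm (idxl k) (idxr k)))
              = rt^-1 *: tens (cl_c R[i] (idxl k) - cl_c R[i] (idxr k))
                              (sp_t u k)] &
        [/\ forall i : 'I_n, Psi (tens 1 (sp_y u i)) = hc_y u i,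
            forall i : 'I_n, Psi (tens (cl_c R[i] i) 1) = hc_c u i,
            forall i : 'I_n,
              Psi (tens 1 (sp_xi u i)) = rt^-1 *: (hc_c u i * hc_x u i) &
            forall k : 'I_n.-1,
              Psi (tens 1 (sp_t u k))
              = rt^-1 *: ((hc_c u (idxr k) - hc_c u (idxl k))
                          * hc_s u (tperm (idxl k) (idxr k)))]].
Proof.
have two_neq0 : 2%:R != 0 :> R[i] by rewrite Num.Theory.pnatr_eq0.
apply: (dahca_tensor_iso two_neq0 hrt (dahca_gens n u) (clifford_gens R[i] n)
  (spin_gens n u)).
- exact: dahca_lift.
- exact: clifford_lift.
- exact: spin_lift.
- move=> D f f' hf hf' ex ey ec es; apply: presented_eq hf hf' _ => -[i|i|i|w].
  + exact: ex.
  + exact: ey.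
  + exact: ec.
  + exact: es.
- by move=> D f f'; exact: presented_eq.
- move=> D f f' hf hf' ex ey et; apply: presented_eq hf hf' _ => -[i|i|k].
  + exact: ex.
  + exact: ey.
  + exact: et.
- move=> D f g hf hg [XiC YC TC]; apply: supercommuting_gen hf hg _ => i [j|j|k] /=.
  + by rewrite scaleN1r; exact: XiC.
  + by rewrite scale1r; exact: YC.
  + by rewrite scaleN1r; exact: TC.
Qed.
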